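(* Let $n\ge 1$, $t>0$, $\beta>0$ and $\delta_n>0$. Let $H$ be a Hermitian operator, $L_1,\dots,L_N$ operators with $\|L_i\|_\infty=1$, $O$ a Hermitian operator with $\|O\|_\infty=1$, all on a $d$-dimensional Hilbert space, let $\gamma_1,\dots,\gamma_N:[0,t]\to\mathbb{R}$ be continuous (possibly taking negative values), and let $\rho(0)$ be a density operator. Let $L_i=\sum_{k=1}^{M_i}q^i_kQ^i_k$ and $O=\sum_{l=1}^{M_O}q^O_lQ^O_l$ be decompositions in a Pauli-kind basis, and put $M=\max_i M_i$ and $\bar\gamma=\max_{i,\,s\in[0,t]}|\gamma_i(s)|$. Let $A_{[i_1,\dots,i_n]}(\vec s)$ and the single-shot random variables $\tilde A_{\vec\omega}(\vec t)$ be as defined in the context. Let $\Omega_n$ be a collection of $|\Omega_n|\geq 1$ pairs $[\vec\omega,\vec t]$ sampled independently and uniformly from $\{1,\dots,N\}^n\times V_n$, with $V_n=\{(s_1,\dots,s_n): t\ge s_1\ge\dots\ge s_n\ge0\}$, one single-shot outcome $\tilde A_{\vec\omega}(\vec t)$ being taken, independently, for each sampled pair. If $$|\Omega_n|>\frac{36M_O^2(2+\beta)}{\delta_n^2}\,\frac{(2\bar\gamma MNt)^{2n}}{n!^2},$$ then with probability higher than $1-e^{-\beta}$, $$\left|\sum_{i_1,\dots,i_n=1}^N\int_{V_n} d\vec s\;\langle A_{[i_1,\dots,i_n]}(\vec s)\rangle-\frac{(Nt)^n}{n!\,|\Omega_n|}\sum_{[\vec\omega,\vec t]\in\Omega_n}\tilde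 A_{\vec\omega}(\vec t)\right|\le\delta_n .$$
   Context: $\|\cdot\|_\infty$ is the operator norm (largest singular value). A Pauli-kind basis is a family $\{Q_j\}_{j=1}^{d^2}$ of operators that are both Hermitian and unitary, with $\mathrm{Tr}(Q_iQ_j)=d\,\delta_{ij}$ (e.g. tensor products of Pauli matrices, $d=2^l$). In the decompositions, for each fixed $i$ the $Q^i_k$ are distinct elements of this basis, likewise the $Q^O_l$; the coefficients are complex numbers. Write $\langle X\rangle=\mathrm{Tr}[X\rho(0)]$ and $X(s)=e^{iHs}Xe^{-iHs}$. For $\vec\omega=[i_1,\dots,i_n]\in\{1,\dots,N\}^n$ and $\vec s=(s_1,\dots,s_n)\in V_n$, define $$A_{[i_1,\dots,i_n]}(\vec s)=e^{s_n\mathcal L_H^\dagger}\mathcal L_D^{s_n,i_n\dagger}\cdots\mathcal L_D^{s_2,i_2\dagger}e^{(s_1-s_2)\mathcal L_H^\dagger}\mathcal L_D^{s_1,i_1\dagger}e^{(t-s_1)\mathcal L_H^\dagger}O ,$$ where $e^{s\mathcal L_H^\dagger}X=e^{iHs}Xe^{-iHs}$ and $\mathcal L_D^{s,i\dagger}X=\gamma_i(s)\big(L_i^\dagger XL_i-\tfrac12\{L_i^\dagger L_i,X\}\big)$. Equivalently, $A_{[i_1,\dots,i_n]}(\vec s)=D_n(D_{n-1}(\cdots D_1(O(t))\cdots))$ with $D_j(X)=\gamma_{i_j}(s_j)\big(L_{i_j}(s_j)^\dagger XL_{i_j}(s_j)-\tfrac12L_{i_j}^\dagger L_{i_j}(s_j)X-\tfrac12XL_{i_j}^\dagger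 L_{i_j}(s_j)\big)$. Single-shot measurement: expand each of the $3^n$ products in $A_{\vec\omega}(\vec t)$ by inserting the Pauli-kind decompositions of every $L_{i}$, $L_i^\dagger$ and of $O$. This gives a finite expression $A_{\vec\omega}(\vec t)=\sum_\alpha c_\alpha W_\alpha$, without collecting terms, where each $W_\alpha$ is an ordered product of time-evolved operators $Q^{i_j}_k(t_j)$ and $Q^O_l(t)$ (hence unitary), and $c_\alpha\in\mathbb C$ is the product of the corresponding coefficients $q$, $\bar q$, $\gamma_{i_j}(t_j)$ and factors $1$ or $-\tfrac12$. For each $\alpha$ the real and imaginary parts of $\langle W_\alpha\rangle$ are each measured once, giving random outcomes $\lambda_\alpha^{r},\lambda_\alpha^{im}\in\{-1,1\}$ with $\mathbb E[\lambda_\alpha^{r}]=\mathrm{Re}\langle W_\alpha\rangle$ and $\mathbb E[\lambda_\alpha^{im}]=\mathrm{Im}\langle W_\alpha\rangle$ (for given $[\vec\omega,\vec t]$). Then $\tilde A_{\vec\omega}(\vec t)=\sum_\alpha\mathrm{Re}\big[c_\alpha(\lambda^r_\alpha+i\lambda^{im}_\alpha)\big]$, a real random variable whose mean, given $[\vec\omega,\vec t]$, is $\langle A_{\vec\omega}(\vec t)\rangle$. *)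

(* Defs.v *)
From HB Require Import structures.
From mathcomp Require Import all_boot all_order all_algebra.
From mathcomp Require Import complex.
From mathcomp Require Import all_classical all_reals all_analysis.

Set Implicit Arguments.
Unset Strict Implicit.
Unset Printing Implicit Defensive.

Import Order.TTheory GRing.Theory Num.Theory.
Import numFieldNormedType.Exports.

Local Open Scope classical_set_scope.
Local Open Scope complex_scope.
Local Open Scope sesquilinear_scope.
Local Open Scope ring_scope.

(* Operators on a d-dimensional Hilbert space are matrices 'M[R[i]]_d, and
   X ^t* is the adjoint of X. *)

Section Operators.
Variables (R : realType) (d : nat).
Local Notation C := R[i].
Implicit Types (X L H rho : 'M[C]_d).

Definition singular_value X (s : R) : Prop :=
  0 <= s /\ eigenvalue (X ^t* *m X) (s ^+ 2)%:C.

(* The set of singular values is finite, and nonempty when 0 < d, so that the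
   supremum is a maximum in that case. *)
Definition opnorm X : R := sup [set s | singular_value X s].

Definition density_operator rho : Prop :=
  [/\ rho \is hermsymmx,
      forall v : 'cV[C]_d, 0 <= (v ^t* *m rho *m v) ord0 ord0 &
      \tr rho = 1].

Definition pauli_kind_basis (Q : 'I_(d ^ 2) -> 'M[C]_d) : Prop :=
  (forall j, Q j \is hermsymmx /\ Q j \is unitarymx) /\
  (forall i j, \tr (Q i *m Q j) = d%:R * (i == j)%:R).

(* The exponential series, summed entry by entry, separately for the real and
   the imaginary parts. *)
Definition expmx_psum X (k : nat) : 'M[C]_d :=
  \sum_(0 <= j < k) (j`!%:R)^-1 *: (X ^+ j).

Definition expmx X : 'M[C]_d :=
  \matrix_(i, j) (limn (fun k => complex.Re (expmx_psum X k i j))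
                  +i* limn (fun k => complex.Im (expmx_psum X k i j))).

(* e^{iHs} X e^{-iHs}: this is both X(s) and e^{s L_H^dagger} X *)
Definition evolve H (s : R) X : 'M[C]_d :=
  expmx ((0 +i* s) *: H) *m X *m expmx ((0 -i* s) *: H).

Definition expect rho X : C := \tr (X *m rho).

Definition dissipator (g : R) L X : 'M[C]_d :=
  g%:C *: (L ^t* *m X *m L
           - 2%:R^-1 *: (L ^t* *m L *m X + X *m (L ^t* *m L))).

End Operators.

(* Lebesgue measure on R^n, as an iterated product of measures *)
Section LebesgueTuple.
Variable R : realType.

Definition cons_pair n (p : R * n.-tuple R) : n.+1.-tuple R :=
  [tuple of p.1 :: p.2].

Lemma measurable_cons_pair n : measurable_fun setT (@cons_pair n).
Proof. exact: measurable_cons. Qed.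

Section LebesgueCons.
Variables (n : nat) (nu : {measure set (n.-tuple R) -> \bar R}).

Definition lebesgue_cons : set (n.+1.-tuple R) -> \bar R :=
  pushforward (@lebesgue_measure R \x^ nu)%E (@cons_pair n).

HB.instance Definition _ := Measure.copy lebesgue_cons
  (@measure_function_pushforward__canonical__measure_function_Measure
     _ _ _ _ _ (@lebesgue_measure R \x^ nu)%E _ (@measurable_cons_pair n)).

End LebesgueCons.

Fixpoint lebesgue_tuple n : {measure set (n.-tuple R) -> \bar R} :=
  match n with
  | 0 => \d_([tuple] : 0.-tuple R)
  | n'.+1 => lebesgue_cons (lebesgue_tuple n')
  end.

(* t >= s_1 >= ... >= s_n >= 0 *)
Definition simplex (t : R) n : set (n.-tuple R) :=
  [set s : n.-tuple R | path >=%R t (rcons s 0)].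

Arguments simplex t n : clear implicits.

Definition simplex_cintegral (t : R) n (f : n.-tuple R -> R[i]) : R[i] :=
  (\int[lebesgue_tuple n]_(s in simplex t n) complex.Re (f s))
  +i* (\int[lebesgue_tuple n]_(s in simplex t n) complex.Im (f s)).

End LebesgueTuple.

Arguments simplex {R} t n.

Section Lindblad.
Variables (R : realType) (d N : nat).
Local Notation C := R[i].
Variables (H : 'M[C]_d) (L : 'I_N -> 'M[C]_d) (O : 'M[C]_d).
Variables (gam : 'I_N -> R -> R) (t : R).

(* a maximum as soon as 0 < N, 0 <= t and every gam i is continuous on [0, t] *)
Definition gamma_bar : R :=
  sup [set `|gam p.1 p.2| | p in [set p : 'I_N * R | 0 <= p.2 <= t]].

(* A_rec r X [:: (i_1, s_1); ...; (i_n, s_n)] is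
   e^{s_n L_H} D_{i_n} ... e^{(s_1 - s_2) L_H} D_{i_1} e^{(r - s_1) L_H} X *)
Fixpoint A_rec (r : R) (X : 'M[C]_d) (l : seq ('I_N * R)) : 'M[C]_d :=
  match l with
  | [::] => evolve H r X
  | (i, s) :: l' =>
      A_rec s (dissipator (gam i s) (L i) (evolve H (r - s) X)) l'
  end.

Definition A_op n (w : n.-tuple 'I_N) (s : n.-tuple R) : 'M[C]_d :=
  A_rec t O (zip w s).

End Lindblad.

(* Expansion of A over a Pauli-kind basis Q. A decomposition of L_i into
   distinct basis elements is given by the set supp i of the indices that occur
   in it (so that M_i = #|supp i|) and by the coefficients q i k, k \in supp i;
   suppO and qO are the same data for O.

   A term of the expansion of A_w is an index (c, l): l selects the basis
   element in O, and the j-th entry (b, k, k') of c selects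
     b = 0 : L^dagger X L             b = 1 : - 1/2 L^dagger L X
     b = 2 : - 1/2 X L^dagger L
   with Q_k for L^dagger (coefficient conj (q k)) and Q_k' for L. *)
Section Expansion.
Variables (R : realType) (d N n : nat).
Local Notation C := R[i].

Definition branch : finType := ('I_3 * 'I_(d ^ 2) * 'I_(d ^ 2))%type.
Definition term_index : finType := (n.-tuple branch * 'I_(d ^ 2))%type.

Variables (H : 'M[C]_d) (Q : 'I_(d ^ 2) -> 'M[C]_d).
Variables (supp : 'I_N -> {set 'I_(d ^ 2)}) (q : 'I_N -> 'I_(d ^ 2) -> C).
Variables (suppO : {set 'I_(d ^ 2)}) (qO : 'I_(d ^ 2) -> C).
Variables (gam : 'I_N -> R -> R) (t : R).

(* the terms that occur in the expansion of A_w *)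
Definition term_of (w : n.-tuple 'I_N) (a : term_index) : bool :=
  (a.2 \in suppO) &&
  [forall j : 'I_n, ((tnth a.1 j).1.2 \in supp (tnth w j))
                    && ((tnth a.1 j).2 \in supp (tnth w j))].

Definition branch_coef (b : 'I_3) : C :=
  if b == 0%N :> nat then 1 else - 2%:R^-1.

Definition coef (w : n.-tuple 'I_N) (s : n.-tuple R) (a : term_index) : C :=
  qO a.2 *
  \prod_(j < n)
    ((gam (tnth w j) (tnth s j))%:C * branch_coef (tnth a.1 j).1.1
     * (q (tnth w j) (tnth a.1 j).1.2)^*
     * q (tnth w j) (tnth a.1 j).2).

Definition branch_word (X : 'M[C]_d) (p : branch * R) : 'M[C]_d :=
  let: ((b, k, k'), s) := p in
  let Qk := evolve H s (Q k) in
  let Qk' := evolve H s (Q k') in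
  match val b with
  | 0 => Qk *m X *m Qk'
  | 1 => Qk *m Qk' *m X
  | _ => X *m Qk *m Qk'
  end.

Definition word (s : n.-tuple R) (a : term_index) : 'M[C]_d :=
  foldl branch_word (evolve H t (Q a.2)) (zip a.1 s).

Definition A_tilde (w : n.-tuple 'I_N) (s : n.-tuple R)
    (lamr lami : term_index -> R) : R :=
  \sum_(a | term_of w a) complex.Re (coef w s a * (lamr a +i* lami a)).

End Expansion.

Section Sampling.
Variables (R : realType) (N n : nat).
Variables (dT : measure_display) (T : measurableType dT).
Variable P : probability T R.

(* [w, s] is uniform on {1..N}^n x V_n: counting measure times Lebesgue
   measure, normalized. *)
Definition uniform_pair (t : R) (w : T -> n.-tuple 'I_N)
    (s : T -> n.-tuple R) : Prop :=
  [/\ forall w0, measurable (w @^-1` [set w0]),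
      measurable_fun setT s,
      forall x, simplex t n (s x) &
      forall w0 (B : set (n.-tuple R)), measurable B ->
        P (w @^-1` [set w0] `&` s @^-1` B) =
        ((N ^ n)%:R^-1
         * (fine (lebesgue_tuple R n (simplex t n `&` B))
            / fine (lebesgue_tuple R n (simplex t n))))%:E].

Variables (d : nat) (H : 'M[R[i]]_d) (rho : 'M[R[i]]_d).
Variable Q : 'I_(d ^ 2) -> 'M[R[i]]_d.
Variables (supp : 'I_N -> {set 'I_(d ^ 2)}) (suppO : {set 'I_(d ^ 2)}).

(* For every term a that occurs in the expansion of A_w0, the outcomes lamr a
   and lami a are +-1-valued on the event w = w0, and their conditional
   expectations given [w, s] are Re <W_a> and Im <W_a>. No assumption is made
   on the joint law of the outcomes of different terms, nor on the entries a
   that are not measured. *)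
Definition single_shot (t : R) (w : T -> n.-tuple 'I_N) (s : T -> n.-tuple R)
    (lamr lami : term_index d n -> T -> R) : Prop :=
  [/\ forall a, measurable_fun setT (lamr a) /\ measurable_fun setT (lami a),
      forall x a, term_of supp suppO (w x) a ->
        (lamr a x = 1 \/ lamr a x = -1) /\ (lami a x = 1 \/ lami a x = -1) &
      forall w0 a (B : set (n.-tuple R)), term_of supp suppO w0 a ->
        measurable B ->
        let E := w @^-1` [set w0] `&` s @^-1` B in
        let meanW x := expect rho (word H Q t (s x) a) in
        (\int[P]_(x in E) (lamr a x)%:E
           = \int[P]_(x in E) (complex.Re (meanW x))%:E)%E /\
        (\int[P]_(x in E) (lami a x)%:E
           = \int[P]_(x in E) (complex.Im (meanW x))%:E)%E].

(* the sigma-algebra generated by a sampled pair and its outcomes *)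
Definition shot_sigma (w : T -> n.-tuple 'I_N) (s : T -> n.-tuple R)
    (lamr lami : term_index d n -> T -> R) : set (set T) :=
  <<s [set E | [\/ exists w0, E = w @^-1` [set w0],
                   exists2 B, measurable B & E = s @^-1` B,
                   exists a, exists2 B, measurable B & E = lamr a @^-1` B |
                   exists a, exists2 B, measurable B & E = lami a @^-1` B]] >>.

(* Subfamilies are covered by taking E j = setT outside of them. *)
Definition independent_sigmas m (G : 'I_m -> set (set T)) : Prop :=
  forall E : 'I_m -> set T, (forall j, G j (E j)) ->
    P (\bigcap_j E j) = (\prod_(j < m) P (E j))%E.

End Sampling.

(* Main.v *)
(** Write e^{isH} in an eigenbasis of H: it is a unitary group with bounded
    measurable entries, so evolving in time commutes with products and adjoints,
    and <A_w(s)> becomes the finite sum of the c_a <W_a>.  By orthonormality of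
    the Pauli-kind basis, sum_k |q_k|^2 = Tr(L^* L) / d <= ||L||^2 = 1, hence
    (sum_k |q_k|)^2 <= M by Cauchy-Schwarz, and each outcome is bounded by
    B = sqrt 2 * M_O * (2 gamma M)^n.  Since V_n has volume t^n / n!, the
    outcome has mean n! / (N t)^n times the target.  A Hoeffding bound (with a
    lossy constant, from e^x <= x + e^{x^2}) for the independent outcomes gives
    the claim: the assumption on |Omega_n| implies
    18 (2 + beta) B^2 < |Omega_n| eps^2 for eps = delta n! / (N t)^n. *)

Require Import Defs.
From HB Require Import structures.
From mathcomp Require Import all_boot all_order all_algebra.
From mathcomp Require Import complex.
From mathcomp Require Import all_classical all_reals all_analysis.
From mathcomp Require Import measurable_realfun.
From mathcomp Require Import ring lra.

Import Order.TTheory GRing.Theory Num.Theory.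
Import numFieldNormedType.Exports.
Import Normc.

Local Open Scope classical_set_scope.
Local Open Scope complex_scope.
Local Open Scope sesquilinear_scope.
Local Open Scope ring_scope.

Set Implicit Arguments.
Unset Strict Implicit.
Unset Printing Implicit Defensive.

(** * Unitary evolution *)

(** The outcomes are known only through their integrals over the events [w = w0], [s \in B], whereas
    the mean of a single shot weights them by coefficients that depend on [s]. One transfer
    principle bridges this gap: under nonnegativity or boundedness, two densities with the same
    integral over every preimage of a measurable set have the same integral against every measurable
    function of the map. It also turns the uniform law into Lebesgue integrals over the simplex, and
    independence of events into the product formula for expectations. Origin of the constants: the 2
    in (2 gamma M)^n is 1 + 1/2 + 1/2, the moduli of the three branch coefficients; M enters once
    per jump because L and its adjoint together contribute (sum_k |q_k|)^2; and 36 is 18 times the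
    square of sqrt 2, the modulus of lambda^r + i lambda^im. *)

Lemma Re_sum {R : realType} (I : Type) (r : seq I) (P : pred I) (F : I -> R[i]) :
  complex.Re (\sum_(i <- r | P i) F i) = \sum_(i <- r | P i) complex.Re (F i).
Proof. by apply: (big_morph (@complex.Re R)) => // -[? ?] []. Qed.

Lemma Im_sum {R : realType} (I : Type) (r : seq I) (P : pred I) (F : I -> R[i]) :
  complex.Im (\sum_(i <- r | P i) F i) = \sum_(i <- r | P i) complex.Im (F i).
Proof. by apply: (big_morph (@complex.Im R)) => // -[? ?] []. Qed.

Lemma ReM {R : realType} (a b : R[i]) : complex.Re (a * b) =
  complex.Re a * complex.Re b - complex.Im a * complex.Im b.
Proof. by case: a b => [? ?] [? ?]. Qed.

Lemma ImM {R : realType} (a b : R[i]) : complex.Im (a * b) =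
  complex.Re a * complex.Im b + complex.Im a * complex.Re b.
Proof. by case: a b => [? ?] [? ?]. Qed.

Definition expi {R : realType} (x : R) : R[i] := cos x +i* sin x.

Lemma expiD {R : realType} (x y : R) : expi (x + y) = expi x * expi y.
Proof. by rewrite /expi cosD sinD /=; simpc; congr Complex; ring. Qed.

Lemma expi0 {R : realType} : expi (0 : R) = 1.
Proof. by rewrite /expi cos0 sin0. Qed.

Lemma conj_expi {R : realType} (x : R) : (expi x)^* = expi (- x).
Proof. by rewrite /expi cosN sinN. Qed.

Definition expi_psum {R : realType} (x : R) (k : nat) : R[i] :=
  \sum_(0 <= j < k) (j`!%:R)^-1 * (0 +i* x) ^+ j.

(** Powers of i alternate between real (even [j]) and imaginary (odd [j]), which separates the
    exponential series into the cosine and the sine series. For even [j] the truncated predecessor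
    in [j.-1./2] is harmless, since its factor [odd j] vanishes. *)
Lemma expi_coeff {R : realType} (x : R) (j : nat) :
  (j`!%:R)^-1 * (0 +i* x) ^+ j = cos_coeff x j +i* sin_coeff x j.
Proof.
have -> : (0 +i* x) = x%:C * 'i%C :> R[i] by simpc.
rewrite exprMn -rmorphXn /=.
have -> : (j`!%:R : R[i])^-1 = ((j`!%:R)^-1)%:C.
  by rewrite fmorphV /= rmorph_nat.
rewrite mulrA -rmorphM /= /cos_coeff /sin_coeff /=.
have -> : 'i%C ^+ j = ((~~ odd j)%:R * (-1) ^+ j./2)
                +i* ((odd j)%:R * (-1) ^+ j.-1./2) :> R[i].
  rewrite -[in LHS](odd_double_half j) exprD -mul2n exprM sqr_i.
  have -> : (-1) ^+ j./2 = ((-1) ^+ j./2)%:C :> R[i].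
    by rewrite rmorphXn rmorphN rmorph1.
  case: (boolP (odd j)) => oj /=; last by rewrite expr0 !mul1r mul0r.
  have -> : j.-1./2 = j./2.
    by rewrite -{1}(odd_double_half j) oj add1n /= doubleK.
  by rewrite expr1 mul0r mul1r; simpc.
by rewrite -exprnP; simpc; congr Complex; ring.
Qed.

Lemma cvg_Re_expi_psum {R : realType} (x : R) :
  (fun k => complex.Re (expi_psum x k)) @ \oo --> cos x.
Proof.
have -> : (fun k => complex.Re (expi_psum x k)) = series (cos_coeff x).
  apply/funext => k; rewrite /expi_psum /series /=.
  by rewrite Re_sum; apply: eq_bigr => j _; rewrite expi_coeff.
by have := @is_cvg_series_cos_coeff R x; rewrite unlock.
Qed.

Lemma cvg_Im_expi_psum {R : realType} (x : R) :
  (fun k => complex.Im (expi_psum x k)) @ \oo --> sin x.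
Proof.
have -> : (fun k => complex.Im (expi_psum x k)) = series (sin_coeff x).
  apply/funext => k; rewrite /expi_psum /series /=.
  by rewrite Im_sum; apply: eq_bigr => j _; rewrite expi_coeff.
by have := @is_cvg_series_sin_coeff R x; rewrite unlock.
Qed.

Section ConjugatedDiagonal.
Variables (C : numClosedFieldType) (d : nat).
Implicit Types (U H : 'M[C]_d) (v w : 'rV[C]_d).

(** For a fixed unitary [U] these matrices form a commutative algebra closed under adjoints, in
    which products, powers and adjoints act entry by entry on [v]. Functions of H are thereby
    computed on its eigenvalues. *)
Definition conjdiag U v : 'M[C]_d := U^t* *m diag_mx v *m U.

Lemma conjdiagM U v w : U \is unitarymx ->
  conjdiag U v *m conjdiag U w = conjdiag U (\row_k (v ord0 k * w ord0 k)).
Proof.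
move=> /unitarymxP UU.
rewrite /conjdiag !mulmxA -(mulmxA _ U (U^t*)) UU mulmx1.
by rewrite -(mulmxA (U^t*) (diag_mx v)) mulmx_diag.
Qed.

Lemma conjdiag1 U : U \is unitarymx -> conjdiag U (const_mx 1) = 1%:M.
Proof.
move=> /unitarymxP /mulmx1C UU.
by rewrite /conjdiag diag_const_mx mulmx1.
Qed.

Lemma conjdiagJ U v : (conjdiag U v)^t* = conjdiag U (\row_k (v ord0 k)^*).
Proof.
rewrite /conjdiag !trmx_mul !map_mxM /= trmxCK mulmxA tr_diag_mx map_diag_mx.
by congr (_ *m diag_mx _ *m _); apply/rowP => k; rewrite !mxE.
Qed.

Lemma conjdiagZ U c v : c *: conjdiag U v = conjdiag U (c *: v).
Proof. by rewrite /conjdiag linearZ /= -scalemxAr -scalemxAl. Qed.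

Lemma conjdiagX U v j : U \is unitarymx ->
  (conjdiag U v) ^+ j = conjdiag U (\row_k (v ord0 k) ^+ j).
Proof.
move=> UU; elim: j => [|j IH].
  rewrite expr0 -[LHS](conjdiag1 UU); congr conjdiag; apply/rowP => k.
  by rewrite !mxE.
rewrite exprSr IH -[_ * _]/(_ *m _) conjdiagM//.
by congr conjdiag; apply/rowP => k; rewrite !mxE exprSr.
Qed.

Lemma conjdiagE U v i j :
  conjdiag U v i j = \sum_l (U^t*) i l * U l j * v ord0 l.
Proof.
by rewrite /conjdiag mxE; apply: eq_bigr => l _; rewrite mul_mx_diag !mxE mulrAC.
Qed.

Lemma hermitian_conjdiag H : H \is hermsymmx ->
  H = conjdiag (spectralmx H) (spectral_diag H).
Proof.
move=> /hermitian_normalmx /orthomx_spectralP.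
by rewrite invmx_unitary ?spectral_unitarymx.
Qed.

End ConjugatedDiagonal.

Section Evolution.
Variables (R : realType) (d : nat) (H : 'M[R[i]]_d).
Hypothesis H_herm : H \is hermsymmx.
Local Notation C := R[i].

Let D k := complex.Re (spectral_diag H ord0 k).

(** This is e^{isH} by functional calculus. The group law and the adjoint are immediate in this
    form; [expmxE] identifies it with the exponential series. *)
Definition unitary_group (s : R) : 'M[C]_d :=
  conjdiag (spectralmx H) (\row_k expi (s * D k)).

Let UU : spectralmx H \is unitarymx.
Proof. exact: spectral_unitarymx. Qed.

Let H_spectral : H = conjdiag (spectralmx H) (\row_k (D k)%:C).
Proof.
have -> : \row_k (D k)%:C = spectral_diag H.
  apply/rowP => k; rewrite mxE RRe_real//.
  by have /mxOverP := hermitian_spectral_diag_real H_herm; apply.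
exact: hermitian_conjdiag.
Qed.

Lemma unitary_groupD s r :
  unitary_group (s + r) = unitary_group s *m unitary_group r.
Proof.
rewrite /unitary_group (conjdiagM _ _ UU); congr (conjdiag _ _); apply/rowP => k.
by rewrite !mxE mulrDl expiD.
Qed.

Lemma unitary_group0 : unitary_group 0 = 1%:M.
Proof.
rewrite -(conjdiag1 UU); congr (conjdiag _ _); apply/rowP => k.
by rewrite !mxE mul0r expi0.
Qed.

Lemma unitary_groupJ s : (unitary_group s)^t* = unitary_group (- s).
Proof.
rewrite /unitary_group conjdiagJ; congr (conjdiag _ _); apply/rowP => k.
by rewrite !mxE mulNr -conj_expi.
Qed.

Let H_exp (z : C) j :
  (z *: H) ^+ j = conjdiag (spectralmx H) (\row_k (z * (D k)%:C) ^+ j).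
Proof.
rewrite [in LHS]H_spectral conjdiagZ (conjdiagX _ _ UU).
by congr (conjdiag _ _); apply/rowP => k; rewrite !mxE.
Qed.

(** Every entry of a partial sum of the matrix series is a linear combination of scalar partial sums
    at the eigenvalues, with coefficients independent of [k]. Convergence thus reduces to that of
    the cosine and sine series. *)
Lemma expmxE s : expmx ((0 +i* s) *: H) = unitary_group s.
Proof.
pose c i j l : C := ((spectralmx H)^t*) i l * spectralmx H l j.
have E k i j : expmx_psum ((0 +i* s) *: H) k i j =
    \sum_l c i j l * expi_psum (s * D l) k.
  rewrite /expmx_psum /expi_psum.
  under eq_bigr do rewrite H_exp.
  rewrite summxE; under [RHS]eq_bigr do rewrite big_distrr/=.
  rewrite exchange_big/=; apply: eq_bigr => a _; rewrite mxE conjdiagE big_distrr/=.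
  apply: eq_bigr => l _; rewrite mxE -/(c i j l) mulrCA.
  by have -> : (0 +i* s) * (D l)%:C = 0 +i* (s * D l) :> R[i] by simpc.
apply/matrixP => i j; rewrite /expmx mxE.
have -> : unitary_group s i j = \sum_l c i j l * expi (s * D l).
  by rewrite conjdiagE; apply: eq_bigr => l _; rewrite -/(c i j l) mxE.
apply/eqP; rewrite eq_complex; apply/andP; split; apply/eqP => /=.
- apply/cvg_lim => //; under eq_fun do rewrite E Re_sum.
  rewrite Re_sum; apply: cvg_big => [|l _]; first exact: add_continuous.
   rewrite ReM; under eq_fun do rewrite ReM.
  by apply: cvgB; apply: cvgMl_tmp; [exact: cvg_Re_expi_psum|exact: cvg_Im_expi_psum].
- apply/cvg_lim => //; under eq_fun do rewrite E Im_sum.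
  rewrite Im_sum; apply: cvg_big => [|l _]; first exact: add_continuous.
   rewrite ImM; under eq_fun do rewrite ImM.
  by apply: cvgD; apply: cvgMl_tmp; [exact: cvg_Im_expi_psum|exact: cvg_Re_expi_psum].
Qed.

Lemma unitary_groupE s i j :
  unitary_group s i j = \sum_l
    (((spectralmx H)^t*) i l * spectralmx H l j) * expi (s * D l).
Proof. by rewrite conjdiagE; apply: eq_bigr => l _; rewrite [in LHS](mxE _ _ ord0). Qed.

(* V is e^{isH}, kept abstract: rewriting in products of complex matrices is
   very slow when the factors unfold to the spectral decomposition. *)
Lemma evolve_unitary_group : exists V : R -> 'M[C]_d,
  [/\ V 0 = 1%:M, forall s r, V (s + r) = V s *m V r,
      forall s, (V s)^t* = V (- s),
      forall s X, evolve H s X = V s *m X *m V (- s) &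
      exists (e : 'I_d -> R) (c : 'I_d -> 'I_d -> 'I_d -> C),
        forall s i j, V s i j = \sum_l c i j l * expi (s * e l)].
Proof.
exists unitary_group; split.
- exact: unitary_group0.
- exact: unitary_groupD.
- exact: unitary_groupJ.
- by move=> s X; rewrite /evolve !expmxE.
- exists D; exists (fun i j l => ((spectralmx H)^t*) i l * spectralmx H l j).
  exact: unitary_groupE.
Qed.

Lemma evolveD s r X : evolve H s (evolve H r X) = evolve H (s + r) X.
Proof.
have [V [_ VD _ VE _]] := evolve_unitary_group.
by rewrite !VE VD opprD [- s - r]addrC (VD (- r)) !mulmxA.
Qed.

Lemma evolveM s X Y : evolve H s (X *m Y) = evolve H s X *m evolve H s Y.
Proof.
have [V [V0 VD _ VE _]] := evolve_unitary_group.
rewrite !VE !mulmxA; congr (_ *m _ *m _).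
by rewrite -(mulmxA (_ *m X)) -VD addNr V0 mulmx1.
Qed.

Lemma evolveJ s X : (evolve H s X)^t* = evolve H s (X^t*).
Proof.
have [V [_ _ VJ VE _]] := evolve_unitary_group.
by rewrite !VE !trmx_mul !map_mxM /= !VJ opprK mulmxA.
Qed.

End Evolution.

Lemma evolveZ (R : realType) d (H : 'M[R[i]]_d) s c X :
  evolve H s (c *: X) = c *: evolve H s X.
Proof. by rewrite /evolve -scalemxAr -scalemxAl. Qed.

Lemma evolve_additive (R : realType) d (H : 'M[R[i]]_d) s X Y :
  evolve H s (X + Y) = evolve H s X + evolve H s Y.
Proof. by rewrite /evolve mulmxDr mulmxDl. Qed.

Lemma evolveN (R : realType) d (H : 'M[R[i]]_d) s X :
  evolve H s (- X) = - evolve H s X.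
Proof. by rewrite /evolve mulmxN mulNmx. Qed.

Lemma evolve_sum (R : realType) d (H : 'M[R[i]]_d) s (I : Type) (r : seq I)
    (P : pred I) (F : I -> 'M[R[i]]_d) :
  evolve H s (\sum_(i <- r | P i) F i) = \sum_(i <- r | P i) evolve H s (F i).
Proof. by rewrite /evolve mulmx_sumr mulmx_suml. Qed.

(** * Expansion over the Pauli-kind basis *)

Lemma big_pair (V : nmodType) (I J : finType) (F : I * J -> V) :
  \sum_p F p = \sum_i \sum_j F (i, j).
Proof. by rewrite pair_bigA; apply: eq_bigr => -[]. Qed.

Section Expansion.
Variables (R : realType) (d : nat).
Local Notation C := R[i].
Implicit Types (X Y L rho : 'M[C]_d).

Lemma adjointM X Y : (X *m Y)^t* = Y^t* *m X^t*.
Proof. by rewrite trmx_mul map_mxM. Qed.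

Lemma adjointZ (c : C) X : (c *: X)^t* = c^* *: X^t*.
Proof. by rewrite linearZ /= map_mxZ. Qed.

Lemma adjointD X Y : (X + Y)^t* = X^t* + Y^t*.
Proof. by rewrite linearD /= map_mxD. Qed.

Lemma adjointN X : (- X)^t* = - X^t*.
Proof. by rewrite linearN /= map_mxN. Qed.

Lemma adjoint_sum (I : Type) (r : seq I) (P : pred I) (F : I -> 'M[C]_d) :
  (\sum_(i <- r | P i) F i)^t* = \sum_(i <- r | P i) (F i)^t*.
Proof.
apply: (big_morph (fun X => X^t*)) => [X Y|]; first exact: adjointD.
by apply/matrixP => i j; rewrite !mxE conjC0.
Qed.

Lemma adjointK X : X^t*^t* = X.
Proof. exact: (@trmxCK R[i]). Qed.

Lemma hermsymmx_adjoint X : X \is hermsymmx -> X^t* = X.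
Proof. by move=> /is_hermitianmxP; rewrite expr0 scale1r => <-. Qed.

Lemma dissipator_adjoint g L X :
  X^t* = X -> (dissipator g L X)^t* = dissipator g L X.
Proof.
move=> XX; rewrite /dissipator adjointZ adjointD adjointN adjointZ adjointD.
rewrite !adjointM adjointK XX !mulmxA; congr (_ *: (_ - _ *: _)).
- exact: conjc_real.
- by rewrite fmorphV /= conjC_nat.
- exact: addrC.
Qed.

Lemma expect_sum rho (I : Type) (r : seq I) (P : pred I) (F : I -> 'M[C]_d) :
  expect rho (\sum_(i <- r | P i) F i) = \sum_(i <- r | P i) expect rho (F i).
Proof. by rewrite /expect mulmx_suml raddf_sum. Qed.

Lemma expectZ rho c X : expect rho (c *: X) = c * expect rho X.
Proof. by rewrite /expect -scalemxAl mxtraceZ. Qed.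

(** Conjugating the trace of a product of two self-adjoint matrices only reverses the order of the
    factors. With [A_op_adjoint] this makes the target a real number, comparable with the real
    estimate. *)
Lemma Im_expect_adjoint rho X : rho^t* = rho -> X^t* = X ->
  complex.Im (expect rho X) = 0.
Proof.
move=> rr XX.
have : (expect rho X)^* = expect rho X.
  rewrite /expect -[in RHS]rr -[in RHS]XX -adjointM mxtrace_mulC.
  rewrite -[RHS]mxtrace_tr; apply: esym; rewrite /mxtrace rmorph_sum.
  by apply: eq_bigr => i _; rewrite !mxE.
case: (expect rho X) => a b [] /eqP; rewrite /= => /eqP e.
lra.
Qed.

Section Branches.
Variables (H : 'M[C]_d) (Q : 'I_(d ^ 2) -> 'M[C]_d).

Lemma branch_wordZ (c : C) X p :
  branch_word H Q (c *: X) p = c *: branch_word H Q X p.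
Proof.
case: p => -[[b k] k'] s; rewrite /branch_word.
case: (val b) => [|[|_]].
- by rewrite -scalemxAr -scalemxAl.
- by rewrite -scalemxAr.
- by rewrite -!scalemxAl.
Qed.

Lemma branch_word_sum (I : Type) (r : seq I) (P : pred I) (F : I -> 'M[C]_d) p :
  branch_word H Q (\sum_(i <- r | P i) F i) p =
  \sum_(i <- r | P i) branch_word H Q (F i) p.
Proof.
case: p => -[[b k] k'] s; rewrite /branch_word.
case: (val b) => [|[|_]].
- by rewrite mulmx_sumr mulmx_suml.
- by rewrite mulmx_sumr.
- by rewrite !mulmx_suml.
Qed.

Lemma foldl_branch_word_lin (I : Type) (r : seq I) (P : pred I)
    (c : I -> C) (F : I -> 'M[C]_d) l :
  foldl (branch_word H Q) (\sum_(i <- r | P i) c i *: F i) l =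
  \sum_(i <- r | P i) c i *: foldl (branch_word H Q) (F i) l.
Proof.
elim: l F => [|p l IH] F //=.
by rewrite branch_word_sum -IH; congr foldl; apply: eq_bigr => i _; exact: branch_wordZ.
Qed.

(** The evolved basis elements stay Hermitian, so the adjoint of the evolved L expands over the same
    operators with conjugated coefficients. Each of the three products of the dissipator then
    becomes a double sum, labelled by one value of the branch. *)
Lemma dissipator_branches (q : 'I_(d ^ 2) -> C) g s L X :
  H \is hermsymmx -> (forall k, Q k \is hermsymmx) ->
  L = \sum_k q k *: Q k ->
  dissipator g (evolve H s L) X =
  \sum_(b : branch d) (g%:C * branch_coef R b.1.1 * (q b.1.2)^* * q b.2) *:
     branch_word H Q X (b, s).
Proof.
move=> Hh Qh ->.
pose K k := evolve H s (Q k).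
have E1 : evolve H s (\sum_k q k *: Q k) = \sum_k q k *: K k.
  by rewrite evolve_sum; apply: eq_bigr => k _; rewrite evolveZ.
have E2 : (\sum_k q k *: K k)^t* = \sum_k (q k)^* *: K k.
  rewrite adjoint_sum; apply: eq_bigr => k _.
  by rewrite adjointZ /K evolveJ// hermsymmx_adjoint.
rewrite E1 /dissipator E2.
have S3 (F : branch d -> 'M[C]_d) : \sum_b F b =
    \sum_k \sum_k' F (ord0, k, k') + \sum_k \sum_k' F (lift ord0 ord0, k, k')
    + \sum_k \sum_k' F (lift ord0 (lift ord0 ord0), k, k').
  rewrite big_pair big_pair.
  by rewrite !big_ord_recl big_ord0 addr0 addrA.
rewrite S3 {S3} /branch_coef/= scalerDr scalerN scalerA scalerDr opprD addrA.
congr (_ + _ + _).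
- rewrite mulmx_suml mulmx_suml scaler_sumr; apply: eq_bigr => k _.
  rewrite mulmx_sumr scaler_sumr; apply: eq_bigr => k' _.
  by rewrite -!scalemxAl -scalemxAr !scalerA mulr1.
- rewrite mulmx_suml mulmx_suml scaler_sumr -sumrN; apply: eq_bigr => k _.
  rewrite mulmx_sumr mulmx_suml scaler_sumr -sumrN; apply: eq_bigr => k' _.
  rewrite -!scalemxAl -scalemxAr -scalemxAl !scalerA -scaleNr.
  by congr (_ *: _); rewrite mulrN !mulNr !mulrA.
- rewrite mulmx_suml mulmx_sumr scaler_sumr -sumrN; apply: eq_bigr => k _.
  rewrite !mulmx_sumr scaler_sumr -sumrN; apply: eq_bigr => k' _.
  rewrite -!scalemxAl -!scalemxAr !scalerA -scaleNr.
  by rewrite mulmxA; congr (_ *: _); rewrite mulrN !mulNr !mulrA.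
Qed.

End Branches.

Lemma big_tuple_cons (V : nmodType) (I : finType) n (F : n.+1.-tuple I -> V) :
  \sum_c F c = \sum_b \sum_(c : n.-tuple I) F [tuple of b :: c].
Proof.
rewrite pair_bigA /= (reindex (fun p : I * n.-tuple I => [tuple of p.1 :: p.2]))//=.
exists (fun c : n.+1.-tuple I => (thead c, [tuple of behead c])) => [[b c] _|c _].
  by rewrite theadE; congr (_, _); apply: val_inj.
by rewrite -tuple_eta.
Qed.

Section Terms.
Variables (N : nat) (H : 'M[C]_d) (L : 'I_N -> 'M[C]_d) (O : 'M[C]_d).
Variables (gam : 'I_N -> R -> R) (t : R).
Variables (Q : 'I_(d ^ 2) -> 'M[C]_d).
Variables (supp : 'I_N -> {set 'I_(d ^ 2)}) (q : 'I_N -> 'I_(d ^ 2) -> C).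
Variables (suppO : {set 'I_(d ^ 2)}) (qO : 'I_(d ^ 2) -> C).
Hypothesis H_herm : H \is hermsymmx.
Hypothesis Q_herm : forall k, Q k \is hermsymmx.
Hypothesis L_dec : forall i, L i = \sum_(k in supp i) q i k *: Q k.
Hypothesis O_dec : O = \sum_(l in suppO) qO l *: Q l.

Let diss Y (p : 'I_N * R) := dissipator (gam p.1 p.2) (evolve H p.2 (L p.1)) Y.

Lemma evolve_dissipator g s L0 X :
  evolve H s (dissipator g L0 X) = dissipator g (evolve H s L0) (evolve H s X).
Proof.
rewrite /dissipator evolveZ evolve_additive evolveN evolveZ evolve_additive.
have EM := evolveM H_herm s.
rewrite (EM (L0^t* *m X) L0) (EM (L0^t*) X) (EM (L0^t* *m L0) X).
by rewrite (EM X (L0^t* *m L0)) (EM (L0^t*) L0) (evolveJ H_herm s L0).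
Qed.

(** Interaction picture: carrying every evolution through the dissipators telescopes the time
    differences to [r], and each jump operator ends up evolved to its own jump time. *)
Lemma A_rec_foldl r X l :
  A_rec H L gam r X l = foldl diss (evolve H r X) l.
Proof.
elim: l r X => [|[i s] l IH] r X //=.
by rewrite IH evolve_dissipator (evolveD H_herm s (r - s)) [s + (r - s)]addrC subrK.
Qed.

Lemma A_op_adjoint n (w : n.-tuple 'I_N) (s : n.-tuple R) :
  O^t* = O -> (A_op H L O gam t w s)^t* = A_op H L O gam t w s.
Proof.
move=> OO; rewrite /A_op A_rec_foldl.
have : (evolve H t O)^t* = evolve H t O by rewrite evolveJ// OO.
elim: (zip w s) (evolve H t O) => [|p l IH] X XX //=.
by apply: IH; exact: dissipator_adjoint.
Qed.

(** Extension by zero lets the expansion run over all tuples of branches; the restriction to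
    [term_of] is made only in [expect_A_op], where every other term has a vanishing factor. *)
Let q' i k := if k \in supp i then q i k else 0.

Let kappa (i : 'I_N) (s : R) (b : branch d) : C :=
  (gam i s)%:C * branch_coef R b.1.1 * (q' i b.1.2)^* * q' i b.2.

(** The start [Y] is left arbitrary so that the induction can peel off the first jump: it replaces
    [Y] by a sum of words, through which the remaining fold is linear. *)
Lemma foldl_diss n (w : n.-tuple 'I_N) (s : n.-tuple R) Y :
  foldl diss Y (zip w s) = \sum_(c : n.-tuple (branch d))
    (\prod_(j < n) kappa (tnth w j) (tnth s j) (tnth c j)) *:
    foldl (branch_word H Q) Y (zip c s).
Proof.
elim: n w s Y => [|n IH] w s Y.
  rewrite (big_pred1 [tuple]) => [|c]; last exact/esym/eqP/tuple0.
  by rewrite big_ord0 scale1r [w]tuple0 [s]tuple0.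
case/tupleP: w => i w; case/tupleP: s => u s /=.
rewrite IH big_tuple_cons exchange_big /=; apply: eq_bigr => c _.
have Ldec i0 : L i0 = \sum_k q' i0 k *: Q k.
  rewrite L_dec big_mkcond; apply: eq_bigr => k _; rewrite /q'.
  by case: ifP => // _; rewrite scale0r.
rewrite /diss /= (dissipator_branches _ _ _ H_herm Q_herm (Ldec i)).
rewrite foldl_branch_word_lin scaler_sumr; apply: eq_bigr => b _.
rewrite big_ord_recl !tnth0 scalerA [in RHS]mulrC; congr (_ * _ *: _).
by apply: eq_bigr => j _; rewrite !tnthS.
Qed.

Lemma expect_A_op rho n (w : n.-tuple 'I_N) (s : n.-tuple R) :
  expect rho (A_op H L O gam t w s) =
  \sum_(a | term_of supp suppO w a)
    coef q qO gam w s a * expect rho (word H Q t s a).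
Proof.
rewrite /A_op A_rec_foldl foldl_diss expect_sum.
have -> : evolve H t O =
    \sum_l (if l \in suppO then qO l else 0) *: evolve H t (Q l).
  rewrite O_dec evolve_sum big_mkcond; apply: eq_bigr => k _.
  by case: ifP => // _; rewrite ?evolveZ// scale0r.
rewrite [RHS]big_mkcond /=.
rewrite big_pair.
apply: eq_bigr => c _.
rewrite expectZ foldl_branch_word_lin expect_sum big_distrr/=.
apply: eq_bigr => l _; rewrite expectZ /word /= mulrA.
rewrite /term_of /coef /=; case: (boolP (l \in suppO)) => lO /=; last first.
  by rewrite mulr0 mul0r.
case: forallP => [cw|/forallP].
  rewrite [in LHS](mulrC _ (qO l)); congr (_ * _ * _); apply: eq_bigr => j _.
  by rewrite /kappa /q'; have /andP[-> ->] := cw j.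
rewrite negb_forall => /existsP[j]; rewrite negb_and => jn.
rewrite (bigD1 j)//= /kappa /q'; case/orP: jn => /negPf ->.
  by rewrite conjC0 mulr0 !mul0r.
by rewrite mulr0 !mul0r.
Qed.

End Terms.
End Expansion.

(** * Bounds on the coefficients *)

Section SpectralTrace.
Variables (C : numClosedFieldType) (d : nat).

(** The operator norm is defined through eigenvalues of the Gram matrix, while the Pauli
    coefficients are controlled by its trace; this lemma links the two. *)
Lemma gram_spectrum (X : 'M[C]_d) : exists D : 'rV[C]_d,
  [/\ forall k, eigenvalue (X^t* *m X) (D ord0 k), forall k, 0 <= D ord0 k &
      \tr (X^t* *m X) = \sum_k D ord0 k].
Proof.
set G := X^t* *m X.
have Gh : G \is hermsymmx.
  by apply/is_hermitianmxP; rewrite expr0 scale1r trmx_mul map_mxM /= trmxCK.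
set U := spectralmx G; set D := spectral_diag G.
have UU : U *m U^t* = 1%:M by apply/unitarymxP/spectral_unitarymx.
have GE : G = U^t* *m diag_mx D *m U := hermitian_conjdiag Gh.
have UG : U *m G = diag_mx D *m U by rewrite GE !mulmxA UU mul1mx.
have DE : diag_mx D = (X *m U^t*)^t* *m (X *m U^t*).
  rewrite trmx_mul map_mxM trmxCK mulmxA -(mulmxA U) -/G UG.
  by rewrite -mulmxA UU mulmx1.
exists D; split => [k|k|].
- apply/eigenvalueP; exists (row k U).
    by rewrite -row_mul UG mul_diag_mx; apply/rowP => l; rewrite !mxE.
  (* An eigenvector must be nonzero: a row of the unitary [U] has inner product 1 with itself. *)
  apply/eqP => rU0; have /(congr1 (fun A : 'M[C]_d => A k k)) := UU.
  rewrite mxE big1 => [|l _]; last first.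
    by have /rowP/(_ l) := rU0; rewrite !mxE => ->; rewrite mul0r.
  by rewrite mxE eqxx => /eqP; rewrite eq_sym oner_eq0.
(* The eigenvalue is a diagonal entry of a Gram matrix, hence a sum of squared moduli. *)
- have /(congr1 (fun A : 'M[C]_d => A k k)) := DE.
  rewrite !mxE eqxx mulr1n => ->; apply: sumr_ge0 => l _.
  by rewrite [X in X * _]mxE [X in X^* * _]mxE mulrC mul_conjC_ge0.
- by rewrite GE -mulmxA mxtrace_mulC -mulmxA UU mulmx1 mxtrace_diag.
Qed.

End SpectralTrace.

Section PauliCoefficients.
Variables (R : realType).
Local Notation C := R[i].

Lemma sqr_normc (z : C) : (normc z ^+ 2)%:C = z^* * z.
Proof.
case: z => a b /=; rewrite sqr_sqrtr ?addr_ge0 ?sqr_ge0//.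
by simpc; congr Complex; ring.
Qed.

Lemma normc_ge0 (z : C) : 0 <= normc z.
Proof. by case: z => a b; exact: sqrtr_ge0. Qed.

Lemma normc_real (x : R) : normc x%:C = `|x|.
Proof. by rewrite /= expr0n /= addr0 sqrtr_sqr. Qed.

Lemma normc_conj (z : C) : normc z^* = normc z.
Proof. by case: z => a b /=; rewrite sqrrN. Qed.

Lemma normc_prod (I : Type) (r : seq I) (P : pred I) (F : I -> C) :
  normc (\prod_(i <- r | P i) F i) = \prod_(i <- r | P i) normc (F i).
Proof. by apply: (big_morph (@normc R)); [exact: normcM|exact: normc1]. Qed.

Lemma ler_Re_normc (z : C) : `|complex.Re z| <= normc z.
Proof.
case: z => a b /=; rewrite -sqrtr_sqr ler_sqrt ?addr_ge0 ?sqr_ge0//.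
by rewrite lerDl sqr_ge0.
Qed.

Variables (d : nat) (Q : 'I_(d ^ 2) -> 'M[C]_d).
Hypothesis Q_basis : pauli_kind_basis Q.
Variables (S : {set 'I_(d ^ 2)}) (q : 'I_(d ^ 2) -> C) (X : 'M[C]_d).
Hypotheses (X_dec : X = \sum_(k in S) q k *: Q k) (X_norm : opnorm X = 1).

(** The trace is a sum of [d] eigenvalues, each the square of a singular value and therefore at most
    1. *)
Lemma trace_gram_opnorm : complex.Re (\tr (X^t* *m X)) <= d%:R.
Proof.
have [D [Deig D_ge0 ->]] := gram_spectrum X.
rewrite Re_sum -[d in d%:R]card_ord -sum1_card natr_sum; apply: ler_sum => k _.
have Dk : D ord0 k = (complex.Re (D ord0 k))%:C.
  by rewrite RRe_real// ger0_real.
set x := complex.Re (D ord0 k) in Dk *.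
have x_ge0 : 0 <= x by rewrite -ler0c -Dk.
have sx : singular_value X (Num.sqrt x).
  by split; [exact: sqrtr_ge0|rewrite sqr_sqrtr// -Dk].
(* A set without a supremum gets the default value 0 from [sup], which a norm equal to 1
   excludes. *)
have hs : has_sup [set s | singular_value X s].
  apply: contrapT => /sup_out; rewrite -/(opnorm X) X_norm => /eqP.
  by rewrite oner_eq0.
have : Num.sqrt x <= 1 by rewrite -X_norm; apply: sup_upper_bound.
by rewrite -{1}sqrtr1 ler_sqrt.
Qed.

Lemma pauli_sum_sqr : \sum_(k in S) normc (q k) ^+ 2 <= 1.
Proof.
case: (pickP (mem S)) => [k0 _|S0]; last by rewrite big_pred0// ler01.
(* An index in [S] inhabits ['I_(d ^ 2)], so [d] is positive and can be cancelled from the trace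
   identity at the end. *)
have d_gt0 : (0 < d)%N by case: (d) k0 => // -[].
have Qh k : Q k ^t* = Q k by apply: hermsymmx_adjoint; case: (Q_basis.1 k).
have tr_gram : \tr (X^t* *m X) = (d%:R * \sum_(k in S) normc (q k) ^+ 2)%:C.
  rewrite X_dec adjoint_sum mulmx_suml raddf_sum /= rmorphM rmorph_nat rmorph_sum.
  rewrite big_distrr; apply: eq_bigr => k kS.
  rewrite adjointZ Qh mulmx_sumr raddf_sum (bigD1 k)//= big1 => [|l /andP[_ lk]].
    rewrite -scalemxAl -scalemxAr !mxtraceZ (Q_basis.2 k k) eqxx addr0.
    by rewrite sqr_normc mulr1 mulrCA mulrC -mulrA mulrCA mulrA.
  rewrite -scalemxAl -scalemxAr !mxtraceZ (Q_basis.2 k l) eq_sym (negPf lk).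
  by rewrite !mulr0.
have := trace_gram_opnorm; rewrite tr_gram /=.
by rewrite -[leRHS]mulr1 ler_pM2l// ltr0n.
Qed.

Lemma pauli_coef_le1 k : k \in S -> normc (q k) <= 1.
Proof.
move=> kS; rewrite -(@ler_pXn2r _ 2)// ?nnegrE ?normc_ge0// expr1n.
apply: le_trans pauli_sum_sqr; rewrite (bigD1 k)//= lerDl.
by apply: sumr_ge0 => l _; exact: sqr_ge0.
Qed.

Lemma pauli_sum_le : \sum_(k in S) normc (q k) <= #|S|%:R.
Proof.
by rewrite -sum1_card natr_sum; apply: ler_sum => k; exact: pauli_coef_le1.
Qed.

Lemma pauli_sqr_sum_le : (\sum_(k in S) normc (q k)) ^+ 2 <= #|S|%:R.
Proof.
apply: (@le_trans _ _ (#|S|%:R * \sum_(k in S) normc (q k) ^+ 2)); last first.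
  by rewrite -[leRHS]mulr1 ler_wpM2l// pauli_sum_sqr.
rewrite expr2 big_distrl /=.
(* Cauchy-Schwarz from a b <= (a^2 + b^2) / 2 applied to every pair of indices. *)
apply: (@le_trans _ _ (\sum_(k in S) \sum_(l in S)
    ((normc (q k) ^+ 2 + normc (q l) ^+ 2) / 2))).
  apply: ler_sum => k _; rewrite big_distrr/=; apply: ler_sum => l _.
  by have := sqr_ge0 (normc (q k) - normc (q l)); lra.
set T := \sum_(k in S) normc (q k) ^+ 2.
have E k : \sum_(l in S) (normc (q k) ^+ 2 + normc (q l) ^+ 2) / 2 =
    (normc (q k) ^+ 2 *+ #|S| + T) / 2.
  by rewrite -mulr_suml big_split/= sumr_const.
under eq_bigr do rewrite E.
rewrite -mulr_suml big_split/= sumr_const sumrMnl -/T -mulr_natl; lra.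
Qed.

End PauliCoefficients.

Lemma prod_sum_tuple (R : comPzSemiRingType) (I : finType) n (f : 'I_n -> I -> R) :
  \sum_(c : n.-tuple I) \prod_(j < n) f j (tnth c j) = \prod_(j < n) \sum_b f j b.
Proof.
elim: n f => [|n IH] f.
  rewrite (big_pred1 [tuple]) => [|c]; last exact/esym/eqP/tuple0.
  by rewrite !big_ord0.
rewrite big_tuple_cons big_ord_recl big_distrl /=; apply: eq_bigr => b _.
rewrite -IH big_distrr /=; apply: eq_bigr => c _.
rewrite big_ord_recl tnth0; congr (_ * _); apply: eq_bigr => j _.
by rewrite tnthS.
Qed.

Section ATildeBound.
Variables (R : realType) (d N n : nat).
Local Notation C := R[i].
Variables (supp : 'I_N -> {set 'I_(d ^ 2)}) (q : 'I_N -> 'I_(d ^ 2) -> C).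
Variables (suppO : {set 'I_(d ^ 2)}) (qO : 'I_(d ^ 2) -> C).
Variables (gam : 'I_N -> R -> R) (M MO G : R).
Hypothesis q_le : forall i, (\sum_(k in supp i) normc (q i k)) ^+ 2 <= M.
Hypothesis qO_le : \sum_(k in suppO) normc (qO k) <= MO.

Let qn i k := if k \in supp i then normc (q i k) else 0.

Lemma normc_branch_coef (b : 'I_3) :
  normc (branch_coef R b) = if b == 0%N :> nat then 1 else 2^-1.
Proof.
rewrite /branch_coef; case: ifP => _; first exact: normc1.
rewrite normcN normcV; congr (_^-1).
have -> : (2 : C) = 2%:C by rewrite rmorph_nat.
by rewrite normc_real normr_nat.
Qed.

(** The modulus of a coefficient is a product over the positions of the word, so the sum over all
    words factors into one sum per jump, times the sum for O. *)
Lemma sum_normc_coef (w : n.-tuple 'I_N) (s : n.-tuple R) :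
  (forall j, `|gam (tnth w j) (tnth s j)| <= G) ->
  \sum_(a | term_of supp suppO w a) normc (coef q qO gam w s a) <=
  MO * (2 * G * M) ^+ n.
Proof.
move=> gamG.
pose f j (b : branch d) := `|gam (tnth w j) (tnth s j)| *
  normc (branch_coef R b.1.1) * qn (tnth w j) b.1.2 * qn (tnth w j) b.2.
have -> : \sum_(a | term_of supp suppO w a) normc (coef q qO gam w s a) =
    (\prod_(j < n) \sum_b f j b) * \sum_(k in suppO) normc (qO k).
  rewrite -prod_sum_tuple big_mkcond big_pair big_distrl /=.
  apply: eq_bigr => c _; rewrite big_distrr/= [RHS]big_mkcond/=.
  apply: eq_bigr => l _; rewrite /term_of /coef /=.
  case: (boolP (l \in suppO)) => lO //=.
  case: forallP => [cw|/forallP].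
    rewrite normcM mulrC normc_prod; congr (_ * _); apply: eq_bigr => j _.
    rewrite !normcM normc_real normc_conj /f /qn.
    by have /andP[-> ->] := cw j.
  rewrite negb_forall => /existsP[j]; rewrite negb_and => jn.
  rewrite (bigD1 j)//= /f /qn; case/orP: jn => /negPf ->.
    by rewrite mulr0 !mul0r.
  by rewrite mulr0 !mul0r.
have fE j : \sum_b f j b = 2 * `|gam (tnth w j) (tnth s j)| *
    (\sum_(k in supp (tnth w j)) normc (q (tnth w j) k)) ^+ 2.
  rewrite big_pair big_pair.
  set S := \sum_(k in _) _.
  have SE : S = \sum_k qn (tnth w j) k by rewrite /S big_mkcond.
  transitivity (\sum_(b : 'I_3) `|gam (tnth w j) (tnth s j)| *
      normc (branch_coef R b) * S ^+ 2).
    apply: eq_bigr => b _; rewrite SE expr2 big_distrl big_distrr/=.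
    apply: eq_bigr => k _; rewrite big_distrr big_distrr/=.
    by apply: eq_bigr => k' _; rewrite /f /= !mulrA.
  rewrite -big_distrl -big_distrr/=; congr (_ * _).
  under eq_bigr do rewrite normc_branch_coef.
  by rewrite !big_ord_recl big_ord0 addr0/= mulrC; congr (_ * _); lra.
rewrite mulrC; apply: ler_pM => //.
- by apply: sumr_ge0 => k _; exact: normc_ge0.
- apply: prodr_ge0 => j _; rewrite fE mulr_ge0 ?sqr_ge0// mulr_ge0//.
- rewrite -[n in _ ^+ n]card_ord -prodr_const; apply: ler_prod => j _.
  rewrite fE mulr_ge0 ?sqr_ge0 ?mulr_ge0//=.
  by rewrite ler_pM ?sqr_ge0 ?mulr_ge0// ler_wpM2l.
Qed.

Lemma A_tilde_bound (w : n.-tuple 'I_N) (s : n.-tuple R)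
    (lamr lami : term_index d n -> R) :
  (forall j, `|gam (tnth w j) (tnth s j)| <= G) ->
  (forall a, term_of supp suppO w a ->
    (lamr a = 1 \/ lamr a = -1) /\ (lami a = 1 \/ lami a = -1)) ->
  `|A_tilde supp q suppO qO gam w s lamr lami| <=
  Num.sqrt 2 * (MO * (2 * G * M) ^+ n).
Proof.
move=> gamG lamE; rewrite /A_tilde (le_trans (ler_norm_sum _ _ _))//.
apply: (@le_trans _ _ (Num.sqrt 2 *
    \sum_(a | term_of supp suppO w a) normc (coef q qO gam w s a))); last first.
  by rewrite ler_wpM2l ?sqrtr_ge0// sum_normc_coef.
rewrite big_distrr/=; apply: ler_sum => a aw.
apply: (le_trans (ler_Re_normc _)); rewrite normcM mulrC ler_wpM2r ?normc_ge0//=.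
(* Both outcomes square to 1, so the complex number they form has modulus sqrt 2. *)
have [lr li] := lamE _ aw.
have -> : lamr a ^+ 2 = 1 by case: lr => ->; rewrite ?sqrrN expr1n.
have -> : lami a ^+ 2 = 1 by case: li => ->; rewrite ?sqrrN expr1n.
by [].
Qed.

End ATildeBound.

(** * The time-ordered simplex *)

Section Simplex.
Variable R : realType.

Lemma simplex_cons (t u : R) n (s : n.-tuple R) :
  simplex t n.+1 [tuple of u :: s] <-> u <= t /\ simplex u n s.
Proof. by rewrite /simplex /=; split => [/andP[]|[? ?]] //; apply/andP. Qed.

Lemma simplex_ge0 (t : R) n (s : n.-tuple R) : simplex t n s -> 0 <= t.
Proof.
elim: n t s => [|n IH] t s; first by rewrite [s]tuple0 /simplex /= andbT.
by case/tupleP: s => u s /simplex_cons[ut /IH u0]; exact: le_trans ut.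
Qed.

Lemma simplex_tnth (t : R) n (s : n.-tuple R) : simplex t n s ->
  forall j, 0 <= tnth s j <= t.
Proof.
elim: n t s => [|n IH] t s; first by move=> _ [].
case/tupleP: s => u s /simplex_cons[ut us] j.
have [->|j0] := eqVneq j ord0; first by rewrite tnth0 (simplex_ge0 us).
have [k ->] : exists k, j = lift ord0 k.
  by case: (unliftP ord0 j) => [k ->|jE]; [exists k|rewrite jE eqxx in j0].
by rewrite tnthS; have /andP[-> /le_trans->] := IH _ _ us k.
Qed.

Lemma measurable_simplex (t : R) n : measurable (simplex t n).
Proof.
pose f i (s : n.-tuple R) := nth 0 (t :: rcons s 0) i.
have mr i : measurable_fun setT (fun s : n.-tuple R => nth 0 (rcons s 0) i).
  have [ltin|lein] := ltnP i n.
    rewrite (_ : (fun _ => _) = @tnth _ _ ^~ (Ordinal ltin)).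
      exact: measurable_tnth.
    by apply/funext => s; rewrite nth_rcons size_tuple ltin (tnth_nth 0).
  rewrite (_ : (fun _ => _) = cst 0); first exact: measurable_cst.
  by apply/funext => s; rewrite nth_rcons size_tuple ltnNge lein /= if_same.
have mf i : measurable_fun setT (f i).
  by case: i => [|i]; [exact: measurable_cst|exact: mr].
have -> : simplex t n =
    \bigcap_(i in `I_n.+1) [set s : n.-tuple R | f i.+1 s <= f i s].
  apply/seteqP; split => s /=.
    by move=> /(pathP 0) h i /= ilt; apply: h; rewrite size_rcons size_tuple.
  move=> h; apply/(pathP 0) => i; rewrite size_rcons size_tuple => ilt.
  exact: h.
apply: bigcap_measurable => [|i _]; first by exists 0%N.
rewrite -[X in measurable X]setTI.
exact: (measurable_fun_ler (mf i.+1) (mf i) measurableT (Y := [set true])).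
Qed.

(** [lebesgue_tuple] is built as a bare measure and shown sigma-finite afterwards; this bundles the
    proof with it, as Tonelli's theorem requires. *)
Definition sigma_finite_pack d (T : measurableType d)
    (mu : {measure set T -> \bar R}) (h : sigma_finite setT mu) :
    {sigma_finite_measure set T -> \bar R} :=
  HB.pack_for (SigmaFiniteMeasure.type T R) (Measure.sort mu)
    (isSFinite.Build _ _ _ _ (sfinite_measure_sigma_finite h))
    (isSigmaFinite.Build _ _ _ _ h).

Let cube n (k : nat) : set (n.-tuple R) :=
  [set s | forall i, tnth s i \in `[- k%:R, k%:R]].

Let measurable_cube n k : measurable (@cube n k).
Proof.
have -> : @cube n k = \bigcap_(i in [set: 'I_n])
    (@tnth _ _ ^~ i @^-1` [set` `[- k%:R, k%:R]]).
  by apply/seteqP; split => s /= h i; [move=> _; exact: h|exact: h].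
apply: fin_bigcap_measurable => [|i _]; first exact: finite_finset.
rewrite -[X in measurable X]setTI.
by apply: measurable_tnth => //; exact: measurable_itv.
Qed.

Lemma lebesgue_tuple_sigma_finite n : sigma_finite setT (lebesgue_tuple R n).
Proof.
exists (@cube n).
  apply/esym/seteqP; split => // s _.
  (* Each coordinate is dominated by the sum of all absolute values, hence by the next integer. *)
  exists (Num.trunc (\sum_i `|tnth s i|)).+1 => //= i; rewrite in_itv /= -ler_norml.
  rewrite (le_trans _ (ltW (truncnS_gt _)))// (bigD1 i)//= lerDl.
  by apply: sumr_ge0.
move=> k; split; first exact: measurable_cube.
elim: n => [|n IH].
  rewrite /= diracE; apply: (@le_lt_trans _ _ 1%:E); rewrite ?ltry//.
  by rewrite lee_fin; case: (_ \in _).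
rewrite /= /lebesgue_cons /pushforward.
have -> : @cons_pair R n @^-1` (@cube n.+1 k) = [set` `[- k%:R, k%:R]] `*` @cube n k.
  apply/seteqP; split => -[u s] /= h.
    split; first by have := h ord0; rewrite tnth0.
    by move=> i; have := h (lift ord0 i); rewrite tnthS.
  move=> i; case: (unliftP ord0 i) => [j ->|->]; rewrite ?tnthS ?tnth0.
    exact: h.2.
  exact: h.1.
rewrite product_measure2E//; last exact: measurable_cube.
rewrite -[X in (X * _)%E]/(lebesgue_measure [set` `[- k%:R, k%:R]]).
rewrite lebesgue_measure_itv/=; case: ifPn => _; last by rewrite mul0e ltry.
by rewrite lte_mul_pinfty// -EFinB ?lee_fin ?lee_tofin// opprK addr_ge0.
Qed.

Lemma integral_pow_fact (t : R) n : 0 <= t ->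
  (\int[lebesgue_measure]_(x in `[0%R, t]) (x ^+ n / n`!%:R)%:E
   = (t ^+ n.+1 / n.+1`!%:R)%:E)%E.
Proof.
(* The fundamental theorem of calculus is applied on a nondegenerate interval; for [t = 0] the
   integral is over a point. *)
rewrite le_eqVlt => /predU1P[<-|t0].
  by rewrite set_itv1 integral_set1 expr0n mul0r.
have cX m : continuous (fun x : R => x ^+ m / m`!%:R).
  move=> x; apply: cvgMr_tmp; exact: exprn_continuous.
have dX (x : R) : is_derive x 1 (fun x => x ^+ n.+1 / n.+1`!%:R) (x ^+ n / n`!%:R).
  rewrite (_ : (fun x => x ^+ n.+1 / n.+1`!%:R) =
      (n.+1`!%:R^-1 \*: (fun x => x ^+ n.+1))); last first.
    by apply/funext => y /=; rewrite mulrC.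
  have d1 : is_derive x 1 (fun y : R => y ^+ n.+1) (n.+1%:R * x ^+ n).
    apply: DeriveDef; first exact: exprn_derivable.
    by rewrite exp_derive /= /GRing.scale /= mulr1.
  have d2 := is_deriveZ n.+1`!%:R^-1 d1.
  apply: (is_derive_eq d2).
  rewrite /GRing.scale /= factS natrM invfM; field.
  by rewrite nat1r !pnatr_eq0 -lt0n fact_gt0.
rewrite (@continuous_FTC2 _ _ (fun x : R => x ^+ n.+1 / n.+1`!%:R))//.
- by rewrite expr0n mul0r sube0.
- by apply: continuous_subspaceT => x; exact: cX.
- split.
  + by move=> x _; have [] := dX x.
  + by apply: cvg_at_right_filter; exact: cX.
  + by apply: cvg_at_left_filter; exact: cX.
- by move=> x _; rewrite derive1E; have [_ ->] := dX x.
Qed.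

(** Slicing at the largest time x leaves a simplex of one dimension less with upper bound x, whose
    volume x^n / n! is integrated over [0, t]. *)
Lemma lebesgue_tuple_simplex (t : R) n : 0 <= t ->
  lebesgue_tuple R n (simplex t n) = (t ^+ n / n`!%:R)%:E.
Proof.
elim: n t => [|n IH] t t_ge0.
  rewrite /= diracE mem_set; last by rewrite /simplex /= andbT.
  by rewrite expr0 fact0 divr1.
rewrite /= /lebesgue_cons /pushforward.
set A := _ @^-1` _.
have mA : measurable A.
  rewrite -[A]setTI; apply: measurable_cons_pair => //; exact: measurable_simplex.
pose nu := sigma_finite_pack (lebesgue_tuple_sigma_finite n).
have xA x : xsection A x = if 0 <= x <= t then simplex x n else set0.
  apply/seteqP; split => s; rewrite /xsection /= inE /A /= => h.
    have [xt xs] := (simplex_cons _ _ _).1 h.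
    by rewrite (simplex_ge0 xs) xt.
  apply/simplex_cons; case: ifPn h => // /andP[_ ->].
  by [].
rewrite -/(product_measure2 lebesgue_measure (lebesgue_tuple R n)) /product_measure2.
(* The product measure integrates slices at fixed later times; Tonelli exchanges them for slices at
   a fixed first time, to which the induction hypothesis applies. *)
transitivity (\int[nu]_y
  fubini_G lebesgue_measure (EFin \o (\1_A : R * n.-tuple R -> R)) y)%E.
  by rewrite indic_fubini_tonelli_GE.
rewrite -(@indic_fubini_tonelli _ _ _ _ _ lebesgue_measure nu)// indic_fubini_tonelli_FE//.
rewrite -integral_pow_fact// [RHS]integral_mkcond; apply: eq_integral => x _ /=.
rewrite xA patchE; case: ifPn => x0t.
  rewrite mem_set /=; last by rewrite in_itv.
  by rewrite -IH//; case/andP: x0t.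
rewrite memNset /=; last by rewrite in_itv; exact/negP.
exact: measure0.
Qed.

End Simplex.

(** * Images of measures with densities *)

Section BoundedIntegrable.
Context d (T : measurableType d) (R : realType).
Variable mu : {finite_measure set T -> \bar R}.

Lemma bounded_integrable D (f : T -> R) (K : R) : measurable D ->
  measurable_fun D f -> (forall x, D x -> `|f x| <= K) ->
  mu.-integrable D (EFin \o f).
Proof.
move=> mD mf fK; apply: measurable_bounded_integrable => //.
  by rewrite ltey_eq fin_num_measure.
exists K; split; first exact: num_real.
by move=> x Kx y Dy; exact: le_trans (fK _ Dy) (ltW Kx).
Qed.

End BoundedIntegrable.

Section DensityImage.
Context d1 d2 (T : measurableType d1) (S : measurableType d2) (R : realType).
Variables (phi : T -> S) (D : set T).
Hypotheses (mphi : measurable_fun setT phi) (mD : measurable D).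

Import HBNNSimple.

(** Transfer for simple functions: the integral against the density [u] only involves integrals of
    [u] over preimages under [phi]. *)
Lemma ge0_integral_nnsfun_mul (mu : {measure set T -> \bar R}) (u : T -> R)
    (h : {nnsfun S >-> R}) :
  measurable_fun setT u -> (forall x, D x -> 0 <= u x) ->
  (\int[mu]_(x in D) (h (phi x) * u x)%:E = \sum_(k \in range h)
     (k%:E * \int[mu]_(x in D `&` phi @^-1` (h @^-1` [set k])) (u x)%:E))%E.
Proof.
move=> mu_ u0.
have mi k : measurable_fun setT (fun x => \1_(h @^-1` [set k]) (phi x) : R).
  by apply: measurableT_comp => //; exact: measurable_indic.
transitivity (\int[mu]_(x in D) (\sum_(k \in range h)
    (k * (\1_(h @^-1` [set k]) (phi x) * u x))%:E)%E)%E.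
  apply: eq_integral => x _; rewrite fsumEFin//; congr EFin.
  rewrite fimfunE mulr_fsuml//; apply: eq_fsbigr => k _.
  by rewrite mulrA.
rewrite ge0_integral_fsum//; last 2 first.
- move=> k; apply/measurable_EFinP; apply: (measurable_funS measurableT) => //.
  by apply: measurable_funM => //; apply: measurable_funM.
- move=> k x Dx; rewrite lee_fin; have [hk|hk] := pselect (h (phi x) = k).
    by rewrite !mulr_ge0 ?u0// -hk.
  by rewrite indicE memNset// mul0r mulr0.
apply: eq_fsbigr => k /set_mem[y _ hy].
under eq_integral do rewrite EFinM.
rewrite ge0_integralZl//.
- rewrite integral_mkcondr; congr (_ * _)%E; apply: eq_integral => x _.
  rewrite patchE indicE; case: ifPn => xk.
    by rewrite (_ : (_ \in _) = true) ?mul1r//; move: xk; rewrite !inE.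
  rewrite (_ : (_ \in _) = false) ?mul0r//; apply/negbTE.
  by move: xk; rewrite !notin_setE.
- apply/measurable_EFinP; apply: (measurable_funS measurableT) => //.
  exact: measurable_funM.
- by move=> x Dx; rewrite lee_fin mulr_ge0 ?u0.
- by rewrite lee_fin -hy.
Qed.

(** Monotone convergence extends the transfer from simple functions to nonnegative measurable
    ones. *)
Lemma ge0_integral_mul_lim (mu : {measure set T -> \bar R}) (u : T -> R)
    (g : S -> R) (mg : measurable_fun setT (EFin \o g)) :
  measurable_fun setT u -> (forall x, D x -> 0 <= u x) ->
  (forall y, 0 <= g y) ->
  (\int[mu]_(x in D) (g (phi x) * u x)%:E = limn (fun n =>
     \int[mu]_(x in D) (nnsfun_approx measurableT mg n (phi x) * u x)%:E))%E.
Proof.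
move=> mu_ u0 g0; rewrite -monotone_convergence//.
- apply: eq_integral => x xD; apply/esym/cvg_lim => //.
  under eq_fun do rewrite EFinM.
  rewrite EFinM; apply: cvgeZr => //.
  by apply: cvg_nnsfun_approx => // y _; rewrite lee_fin.
- move=> n; apply/measurable_EFinP; apply: (measurable_funS measurableT) => //.
  by apply: measurable_funM => //; exact: measurableT_comp.
- by move=> n x Dx; rewrite lee_fin mulr_ge0 ?u0.
- move=> x Dx a b ab; rewrite lee_fin ler_wpM2r ?u0//.
  exact/lefP/nd_nnsfun_approx.
Qed.

End DensityImage.

Section TwoSpaces.
Import HBNNSimple.

(* The measures with densities u and v on D and D' have the same image under
   phi and phi', hence the same integrals of functions on S. *)
Lemma ge0_integral_transfer d1 d1' d2 (T : measurableType d1)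
    (T' : measurableType d1') (S : measurableType d2) (R : realType)
    (phi : T -> S) (D : set T) (phi' : T' -> S) (D' : set T')
    (mu : {measure set T -> \bar R}) (mu' : {measure set T' -> \bar R})
    (u : T -> R) (v : T' -> R) (g : S -> R) :
  measurable_fun setT phi -> measurable D ->
  measurable_fun setT phi' -> measurable D' ->
  measurable_fun setT u -> (forall x, D x -> 0 <= u x) ->
  measurable_fun setT v -> (forall x, D' x -> 0 <= v x) ->
  measurable_fun setT g -> (forall y, 0 <= g y) ->
  (forall B, measurable B ->
    \int[mu]_(x in D `&` phi @^-1` B) (u x)%:E =
    \int[mu']_(x in D' `&` phi' @^-1` B) (v x)%:E)%E ->
  (\int[mu]_(x in D) (g (phi x) * u x)%:E =
   \int[mu']_(x in D') (g (phi' x) * v x)%:E)%E.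
Proof.
move=> mphi mD mphi' mD' mu_ u0 mv v0 mg g0 uv.
have mgE : measurable_fun setT (EFin \o g) by exact/measurable_EFinP.
rewrite !(ge0_integral_mul_lim _ _ _ mgE)//; congr (limn _); apply/funext => n.
rewrite !ge0_integral_nnsfun_mul//; apply: eq_fsbigr => k _.
by rewrite uv.
Qed.

End TwoSpaces.

Section Transfer.
Context d1 d2 (T : measurableType d1) (S : measurableType d2) (R : realType).
Variables (phi : T -> S) (D : set T).
Hypotheses (mphi : measurable_fun setT phi) (mD : measurable D).

Let mpre B : measurable B -> measurable (phi @^-1` B).
Proof. by move=> mB; rewrite -[X in measurable X]setTI; exact: mphi. Qed.

(** The signed version: adding the common bound [K] to both factors makes them nonnegative. After
    expanding the product, the extra terms agree on the two sides, the one with the densities alone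
    by taking [B] to be the whole space. *)
Lemma Rintegral_transfer (mu : {finite_measure set T -> \bar R}) (u v : T -> R)
    (g : S -> R) (K : R) :
  measurable_fun setT u -> (forall x, D x -> `|u x| <= K) ->
  measurable_fun setT v -> (forall x, D x -> `|v x| <= K) ->
  measurable_fun setT g -> (forall y, `|g y| <= K) ->
  (forall B, measurable B ->
    \int[mu]_(x in D `&` phi @^-1` B) (u x)%:E =
    \int[mu]_(x in D `&` phi @^-1` B) (v x)%:E)%E ->
  \int[mu]_(x in D) (g (phi x) * u x) = \int[mu]_(x in D) (g (phi x) * v x).
Proof.
move=> mu_ uK mv vK mg gK uv.
have sh (a : R) : `|a| <= K -> 0 <= a + K by rewrite ler_norml; lra.
have gb (w : T -> R) : (forall x, D x -> `|w x| <= K) -> measurable_fun setT w ->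
    mu.-integrable D (EFin \o (fun x => g (phi x) * w x)).
  move=> wK mw; apply: (@bounded_integrable _ _ _ mu D _ (K * K)) => //.
    apply: (measurable_funS measurableT) => //; apply: measurable_funM => //.
    exact: measurableT_comp.
  by move=> x Dx; rewrite normrM ler_pM// wK.
have wb (w : T -> R) : (forall x, D x -> `|w x| <= K) -> measurable_fun setT w ->
    mu.-integrable D (EFin \o w).
  move=> wK mw; apply: (@bounded_integrable _ _ _ mu D _ K) => //.
  exact: (measurable_funS measurableT).
have gbi : mu.-integrable D (EFin \o (fun x => g (phi x))).
  apply: (@bounded_integrable _ _ _ mu D _ K) => //.
  by apply: (measurable_funS measurableT) => //; exact: measurableT_comp.
have ci (c : R) : mu.-integrable D (EFin \o (fun=> c)).
  exact: (@bounded_integrable _ _ _ mu D _ `|c|).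
have expand (w : T -> R) : (forall x, D x -> `|w x| <= K) -> measurable_fun setT w ->
    \int[mu]_(x in D) ((g (phi x) + K) * (w x + K)) =
    \int[mu]_(x in D) (g (phi x) * w x) + K * \int[mu]_(x in D) w x
    + (K * \int[mu]_(x in D) (g (phi x)) + \int[mu]_(x in D) (K * K)).
  move=> wK mw.
  under eq_Rintegral do rewrite mulrDl !mulrDr (mulrC _ K) addrACA.
  have i1 := gb w wK mw; have i2 := wb w wK mw.
  have Zi (f : T -> R) : mu.-integrable D (EFin \o f) ->
      mu.-integrable D (EFin \o (fun x => K * f x)).
    by move=> fi; have := integrableZl mD K fi.
  have Di (f1 f2 : T -> R) : mu.-integrable D (EFin \o f1) ->
      mu.-integrable D (EFin \o f2) ->
      mu.-integrable D (EFin \o (fun x => f1 x + f2 x)).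
    by move=> f1i f2i; have := integrableD mD f1i f2i.
  rewrite RintegralD//; [|by apply: Di => //; exact: Zi|by apply: Di => //; exact: Zi].
  by rewrite !RintegralD ?RintegralZl//; exact: Zi.
have shift : \int[mu]_(x in D) ((g (phi x) + K) * (u x + K)) =
    \int[mu]_(x in D) ((g (phi x) + K) * (v x + K)).
  congr fine.
  apply: (@ge0_integral_transfer _ _ _ _ _ _ _ phi D phi D mu mu
    (fun x => u x + K) (fun x => v x + K) (fun y => g y + K)) => //.
  - exact: measurable_funD.
  - by move=> x Dx; apply: sh; exact: uK.
  - exact: measurable_funD.
  - by move=> x Dx; apply: sh; exact: vK.
  - exact: measurable_funD.
  - by move=> y; exact: sh.
  - move=> B mB; have mDB : measurable (D `&` phi @^-1` B).
      by apply: measurableI => //; exact: mpre.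
    have DBsub : D `&` phi @^-1` B `<=` D by move=> x [].
    under eq_integral do rewrite EFinD.
    under [RHS]eq_integral do rewrite EFinD.
    by rewrite !integralD ?uv//; apply: (integrableS mD) => //;
      by [exact: wb|exact: ci].
have := shift; rewrite !expand//.
have -> : \int[mu]_(x in D) u x = \int[mu]_(x in D) v x.
  by have := uv setT measurableT; rewrite preimage_setT setIT /Rintegral => ->.
by move=> /addIr /addIr.
Qed.

End Transfer.

(** * Hoeffding's inequality *)

(** For a centred variable Y the linear term integrates to 0, which leaves a bound on the mean of
    e^Y by that of e^{Y^2}. Beyond 1 it holds because x <= x^2; up to 1 it follows from e^x <= 1 + x
    + x^2. *)
Lemma expR_le_id_sqr (R : realType) (x : R) : expR x <= x + expR (x ^+ 2).
Proof.
have [x1|x1] := leP x 1; last first.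
  apply: (@le_trans _ _ (expR (x ^+ 2))); last by rewrite lerDr; lra.
  by rewrite ler_expR; nra.
apply: (@le_trans _ _ (x + (1 + x ^+ 2))); last first.
  by rewrite lerD2l expR_ge1Dx.
(* The derivative y (1 - y) e^{-y} is negative before 0 and nonnegative on [0, 1], so on the
   half-line up to 1 the minimum of [g] is its value 1 at 0. *)
pose g (y : R) := (1 + y + y ^+ 2) * expR (- y).
have dg (y : R) : is_derive y 1 g (y * (1 - y) * expR (- y)).
  have d1 : is_derive y 1 (fun y : R => 1 + y + y ^+ 2) (1 + 2 * y).
    have d3 : is_derive y 1 (fun y : R => y ^+ 2) (2 * y).
      apply: DeriveDef; first exact: exprn_derivable.
      by rewrite exp_derive /= /GRing.scale /= mulr1 expr1.
    have d4 := is_deriveD (is_deriveD (is_derive_cst (1 : R) y 1) (is_derive_id y 1)) d3.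
    by apply: (is_derive_eq d4); rewrite add0r.
  have d2 : is_derive y 1 (fun y : R => expR (- y)) (- expR (- y)).
    have d5 := is_derive1_comp (is_derive_expR (- y)) (is_deriveN (is_derive_id y 1)).
    by apply: (is_derive_eq d5); rewrite mulrN1.
  have d6 := is_deriveM d1 d2.
  by apply: (is_derive_eq d6); rewrite /GRing.scale /=; ring.
have g0 : g 0 = 1 by rewrite /g oppr0 expR0 expr0n /= !addr0 mulr1.
have gx : 1 <= g x.
  rewrite -g0; have [x0|x0] := leP 0 x.
    apply: (@ger0_derive1_le_cc _ g 0 1) => //.
    - move=> y; rewrite in_itv/= => /andP[y0 y1]; rewrite derive1E.
      have [_ ->] := dg y; apply: mulr_ge0; last exact: expR_ge0.
      by apply: mulr_ge0; lra.
    - apply: continuous_subspaceT => y.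
      by apply/differentiable_continuous/derivable1_diffP; have [] := dg y.
    - by rewrite in_itv/= lexx ler01.
    - by rewrite in_itv/= x0 x1.
  apply: (@ler0_derive1_le_cc _ g x 0) => //.
  - move=> y; rewrite in_itv/= => /andP[y0 y1]; rewrite derive1E.
    have [_ ->] := dg y; rewrite -oppr_ge0 -mulNr.
    apply: mulr_ge0; last exact: expR_ge0.
    by nra.
  - apply: continuous_subspaceT => y.
    by apply/differentiable_continuous/derivable1_diffP; have [] := dg y.
  - by rewrite in_itv/= lexx (ltW x0).
  - by rewrite in_itv/= lexx (ltW x0).
  - exact: ltW.
have : expR x * 1 <= expR x * g x by rewrite ler_pM2l// expR_gt0.
have -> : expR x * g x = 1 + x + x ^+ 2.
  by rewrite /g mulrCA -expRD subrr expR0 mulr1.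
by lra.
Qed.

Section Independence.
Context d (T : measurableType d) (R : realType) (P : probability T R).
Variables (m : nat) (X : 'I_m -> T -> R).
Hypothesis mX : forall j, measurable_fun setT (X j).
Hypothesis X_indep : forall B : 'I_m -> set R, (forall j, measurable (B j)) ->
  P (\bigcap_j (X j @^-1` B j)) = (\prod_(j < m) P (X j @^-1` B j))%E.

Let mpre j B : measurable B -> measurable (X j @^-1` B).
Proof. by move=> mB; rewrite -[X in measurable X]setTI; exact: mX. Qed.

(** Indicators are exchanged for the functions [f j] one index at a time: [h k] has functions at the
    indices below [k] and indicators at the others. At [k = 0] the formula is independence of
    events, at [k = m] it is the claim. *)
Lemma indep_expectation (f : 'I_m -> R -> R) (e : 'I_m -> R) :
  (forall j, measurable_fun setT (f j)) -> (forall j y, 0 <= f j y) ->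
  (forall j, \int[P]_x (f j (X j x))%:E = (e j)%:E)%E ->
  (\int[P]_x (\prod_(j < m) f j (X j x))%:E = (\prod_(j < m) e j)%:E)%E.
Proof.
move=> mf f0 fe.
have e0 j : 0 <= e j.
  by rewrite -lee_fin -fe; apply: integral_ge0 => x _; rewrite lee_fin.
pose h (k : nat) (B : 'I_m -> set R) (j : 'I_m) x :=
  if (j < k)%N then f j (X j x) else \1_(B j) (X j x) : R.
pose c (k : nat) (B : 'I_m -> set R) (j : 'I_m) :=
  if (j < k)%N then e j else fine (P (X j @^-1` B j)).
have h0 k B j x : 0 <= h k B j x by rewrite /h; case: ifP.
have c0 k B j : 0 <= c k B j by rewrite /c; case: ifP => // _; exact: fine_ge0.
have mh k B j : (forall j, measurable (B j)) -> measurable_fun setT (h k B j).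
  move=> mB; rewrite /h; case: (j < k)%N; exact: measurableT_comp.
suff H k B : (k <= m)%N -> (forall j, measurable (B j)) ->
    (\int[P]_x (\prod_(j < m) h k B j x)%:E = (\prod_(j < m) c k B j)%:E)%E.
  have := H m (fun=> setT) (leqnn m) (fun=> measurableT).
  under eq_integral do under eq_bigr do rewrite /h ltn_ord.
  by move=> ->; congr EFin; apply: eq_bigr => j _; rewrite /c ltn_ord.
elim: k B => [|k IH] B km mB.
  have -> : (\prod_(j < m) c 0%N B j)%:E = P (\bigcap_j (X j @^-1` B j)).
    rewrite X_indep// (big_morph EFin EFinM erefl); apply: eq_bigr => j _.
    by rewrite /c ltn0 fineK// fin_num_measure//; exact: mpre.
  set A := \bigcap_j _.
  have mA : measurable A.
    by apply: fin_bigcap_measurable => // j _; exact: mpre.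
  have -> : P A = (\int[P]_x (\1_A x)%:E)%E by rewrite integral_indic// setIT.
  apply: eq_integral => x _; congr EFin; rewrite indicE.
  case: (boolP (x \in _)) => [|]; rewrite ?inE ?notin_setE => hx.
    by rewrite big1// => j _; rewrite /h ltn0 indicE mem_set//; exact: hx.
  have [j jB] : exists j, ~ (X j @^-1` B j) x.
    by apply: contrapT => /forallNP hB; apply: hx => j _; exact: contrapT.
  by rewrite (bigD1 j)//= /h ltn0 indicE memNset// mul0r.
pose i0 := Ordinal km.
pose W x := \prod_(j < m | j != i0) h k B j x.
pose C := \prod_(j < m | j != i0) c k B j.
have neq j : j != i0 -> (j < k.+1)%N = (j < k)%N.
  move=> ji; rewrite ltnS leq_eqVlt; case: eqP => // jk.
  by case/eqP: ji; apply: val_inj.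
have C0 : 0 <= C by apply: prodr_ge0.
have mW : measurable_fun setT W.
  rewrite /W; under eq_fun do rewrite big_mkcond.
  by apply: measurable_prod => j _; case: (j != i0); [exact: mh|exact: measurable_cst].
have -> : \prod_(j < m) c k.+1 B j = e i0 * C.
  rewrite (bigD1 i0)//= {1}/c ltnSn; congr (_ * _); apply: eq_bigr => j ji.
  by rewrite /c neq.
transitivity (\int[P]_x (f i0 (X i0 x) * W x)%:E)%E.
  apply: eq_integral => x _; rewrite (bigD1 i0)//= {1}/h ltnSn.
  by congr (_ * _)%:E; apply: eq_bigr => j ji; rewrite /h neq.
(* The product [W] of the other factors and the constant [C] have the same integral over every
   preimage under [X i0]: this is the induction hypothesis with the set at [i0] chosen freely. *)
rewrite (@ge0_integral_transfer _ _ _ _ _ _ _ (X i0) setT (X i0) setT P P W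
  (cst C) (f i0))//=.
- under eq_integral do rewrite EFinM muleC.
  rewrite ge0_integralZl//=; last 2 first.
  + by apply/measurable_EFinP; exact: measurableT_comp.
  + by move=> x _; rewrite lee_fin.
  by rewrite fe -EFinM mulrC.
- by move=> x _; apply: prodr_ge0.
move=> B0 mB0; rewrite setTI.
pose B' j := if j == i0 then B0 else B j.
have mB' j : measurable (B' j) by rewrite /B'; case: ifP.
have := IH B' (ltnW km) mB'.
have -> : \prod_(j < m) c k B' j = fine (P (X i0 @^-1` B0)) * C.
  rewrite (bigD1 i0)//= {1}/c ltnn /B' eqxx; congr (_ * _).
  by apply: eq_bigr => j ji; rewrite /c (negPf ji).
rewrite integral_cst; last exact: mpre.
rewrite EFinM fineK; last by rewrite fin_num_measure//; exact: mpre.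
rewrite muleC => <-; rewrite -[X in (\int[P]_(x in X) _)%E]setTI integral_mkcondr.
apply: eq_integral => x _; rewrite (bigD1 i0)//= patchE {1}/h ltnn {1}/B' eqxx indicE.
have -> : \prod_(i < m | i != i0) h k B' i x = W x.
  by apply: eq_bigr => j ji; rewrite /h /B' (negPf ji).
case: ifPn => xB.
  by rewrite mem_set ?mul1r//; move: xB; rewrite inE.
by rewrite memNset ?mul0r//; move: xB; rewrite notin_setE.
Qed.

Variables (mu B : R).
Hypothesis X_bound : forall j x, `|X j x| <= B.
Hypothesis X_mean : forall j, \int[P]_x X j x = mu.

(** [expR_le_id_sqr] is integrated at s (X - mu): the linear part vanishes, and |X - mu| <= 2 K
    gives the exponent (2 s K)^2. *)
Lemma moment_generating_le (s K : R) j : B <= K ->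
  \int[P]_x expR (s * (X j x - mu)) <= expR (4 * s ^+ 2 * K ^+ 2).
Proof.
move=> BK.
have Ec (c : R) : \int[P]_x c = c.
  by rewrite Rintegral_cst// (_ : fine _ = 1) ?mulr1//; have /= -> := probability_setT P.
have iX : P.-integrable setT (EFin \o X j).
  exact: (@bounded_integrable _ _ _ P _ _ B).
have muB : `|mu| <= B.
  rewrite -(X_mean j) (le_trans (le_normr_Rintegral _ _))//.
  have := @le_Rintegral _ _ _ P setT (fun x => `|X j x|) (fun=> B).
  rewrite Ec; apply => //.
  - exact: integrable_norm.
  - exact: (@bounded_integrable _ _ _ P _ _ `|B|).
have ic (c : R) : P.-integrable setT (EFin \o (fun=> c)).
  exact: (@bounded_integrable _ _ _ P _ _ `|c|).
have Yb x : `|X j x - mu| <= 2 * K.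
  rewrite (le_trans (ler_normB _ _))//; have := X_bound j x; lra.
have iY : P.-integrable setT (EFin \o (fun x => s * (X j x - mu))).
  apply: (@bounded_integrable _ _ _ P _ _ (`|s| * (2 * K))) => //.
    by apply: measurable_funM => //; exact: measurable_funB.
  by move=> x _; rewrite normrM ler_wpM2l.
apply: (@le_trans _ _ (\int[P]_x (s * (X j x - mu) + expR (4 * s ^+ 2 * K ^+ 2)))).
  apply: le_Rintegral => //.
  - apply: (@bounded_integrable _ _ _ P _ _ (expR (`|s| * (2 * K)))) => //.
      apply: measurableT_comp => //.
      by apply: measurable_funM => //; exact: measurable_funB.
    move=> x _; rewrite ger0_norm ?expR_ge0// ler_expR.
    by rewrite (le_trans (ler_norm _))// normrM ler_wpM2l.
  - have := integrableD measurableT iY (ic (expR (4 * s ^+ 2 * K ^+ 2))).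
    exact.
  move=> x _; apply: (le_trans (expR_le_id_sqr _)); rewrite lerD2l ler_expR.
  have -> : 4 * s ^+ 2 * K ^+ 2 = s ^+ 2 * (2 * K) ^+ 2 by ring.
  rewrite exprMn ler_wpM2l ?sqr_ge0// -[leLHS]real_normK ?num_real//.
  by rewrite ler_pXn2r// nnegrE// (le_trans (normr_ge0 _) (Yb x)).
rewrite RintegralD// RintegralZl//; last first.
  by have := integrableB measurableT iX (ic mu); exact.
by rewrite RintegralB// X_mean !Ec subrr mulr0 add0r lexx.
Qed.

(** Chernoff's method. The sign of [s] is free, so that both tails are covered. *)
Lemma exp_tail (s K a : R) : B <= K ->
  (P [set x | (a <= \sum_(j < m) s * (X j x - mu))%R]
   <= (expR (4 * s ^+ 2 * K ^+ 2 *+ m - a)%R)%:E)%E.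
Proof.
move=> BK; set A := [set x | _].
pose S x := \sum_(j < m) s * (X j x - mu).
have mS : measurable_fun setT S.
  apply: measurable_sum => j; apply: measurable_funM => //.
  exact: measurable_funB.
have mA : measurable A.
  rewrite -[A]setTI.
  exact: (measurable_fun_ler (measurable_cst a) mS measurableT (Y := [set true])).
pose f (j : 'I_m) (y : R) := expR (s * (y - mu)).
pose e (j : 'I_m) := \int[P]_x f j (X j x).
have mfj j : measurable_fun setT (f j).
  apply: measurableT_comp => //; apply: measurable_funM => //.
  exact: measurable_funB.
have fe j : (\int[P]_x (f j (X j x))%:E = (e j)%:E)%E.
  rewrite /e /Rintegral fineK//.
  have muP : (\int[P]_x (f j (X j x))%:E)%E \is a fin_num; last exact: muP.
  apply: integrable_fin_num => //.
  apply: (@bounded_integrable _ _ _ P _ _ (expR (`|s| * (B + `|mu|)))) => //.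
    exact: measurableT_comp.
  move=> x _; rewrite /f ger0_norm ?expR_ge0// ler_expR.
  rewrite (le_trans (ler_norm _))// normrM ler_wpM2l//.
  by rewrite (le_trans (ler_normB _ _))// lerD2r.
have := @indep_expectation f e mfj (fun j y => expR_ge0 _) fe.
have -> : (fun x => (\prod_(j < m) f j (X j x))%:E) = (fun x => (expR (S x))%:E).
  by apply/funext => x; rewrite /S expR_sum.
move=> ES.
(* Markov's inequality, from e^a times the indicator of [A] being at most e^S. *)
have step : ((expR a)%:E * P A <= \int[P]_x (expR (S x))%:E)%E.
  have -> : P A = (\int[P]_x (\1_A x)%:E)%E by rewrite integral_indic// setIT.
  rewrite -ge0_integralZl//; last by apply/measurable_EFinP; exact: measurable_indic.
  under eq_integral do rewrite -EFinM.
  apply: ge0_le_integral => //.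
  - by apply/measurable_EFinP; exact: measurable_funM.
  - by apply/measurable_EFinP; exact: measurableT_comp.
  - move=> x _; rewrite lee_fin indicE; case: (boolP (x \in A)) => xA.
      by rewrite mulr1 ler_expR; move: xA; rewrite inE.
    by rewrite mulr0 expR_ge0.
have e_le : \prod_(j < m) e j <= expR (4 * s ^+ 2 * K ^+ 2 *+ m).
  rewrite -mulr_natl expRM_natl.
  rewrite -[m in _ ^+ m]card_ord -prodr_const; apply: ler_prod => j _.
  rewrite Rintegral_ge0/=; last by move=> x _; exact: expR_ge0.
  exact: moment_generating_le.
have PA := fineK (fin_num_measure P A mA).
rewrite -PA -EFinM ES lee_fin in step; rewrite -PA lee_fin expRD expRN.
by rewrite ler_pdivlMr ?expR_gt0// mulrC (le_trans step).
Qed.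

Lemma hoeffding (eps beta : R) : (0 < m)%N -> 0 < eps -> 0 < beta -> 0 <= B ->
  18 * (2 + beta) * B ^+ 2 < m%:R * eps ^+ 2 ->
  ((1 - expR (- beta))%:E <
   P [set x | (`|\sum_(j < m) X j x - m%:R * mu| <= m%:R * eps)%R])%E.
Proof.
move=> m0 eps0 beta0 B0 hB.
have m0' : 0 < m%:R :> R by rewrite ltr0n.
(* K >= B turns the hypothesis into an equality, so that s below is finite
   even when B = 0. *)
pose K2 := m%:R * eps ^+ 2 / (18 * (2 + beta)).
have b2 : 0 < 18 * (2 + beta) by lra.
have K2_gt0 : 0 < K2 by rewrite divr_gt0// mulr_gt0// exprn_gt0.
pose K := Num.sqrt K2.
have KK : K ^+ 2 = K2 by rewrite sqr_sqrtr// ltW.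
have K_gt0 : 0 < K by rewrite sqrtr_gt0.
have BK : B <= K.
  rewrite -(@ler_pXn2r _ 2)// ?nnegrE ?(ltW K_gt0)// KK /K2 ler_pdivlMr//.
  by rewrite mulrC ltW.
(* The minimizer of 4 m s^2 K^2 - s m eps. The minimum is - m eps^2 / (16 K^2), and 18 / 16 = 9 / 8
   by the choice of [K2]. *)
pose s := eps / (8 * K2).
have expo (s' : R) : s' ^+ 2 = s ^+ 2 ->
    4 * s' ^+ 2 * K ^+ 2 *+ m - s * (m%:R * eps) = - ((2 + beta) * (9 / 8)).
  move=> ->; rewrite KK /s -mulr_natl /K2; field.
  by rewrite !gt_eqF//; lra.
set A := [set x | _].
pose A1 := [set x | s * (m%:R * eps) <= \sum_(j < m) s * (X j x - mu)].
pose A2 := [set x | s * (m%:R * eps) <= \sum_(j < m) (- s) * (X j x - mu)].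
have mS (c : R) : measurable_fun setT (fun x => \sum_(j < m) c * (X j x - mu)).
  apply: measurable_sum => j; apply: measurable_funM => //.
  exact: measurable_funB.
have mAi (c : R) : measurable
    [set x | s * (m%:R * eps) <= \sum_(j < m) c * (X j x - mu)].
  rewrite -[X in measurable X]setTI.
  exact: (measurable_fun_ler (measurable_cst _) (mS c) measurableT (Y := [set true])).
have s_gt0 : 0 < s by rewrite divr_gt0// mulr_gt0.
have sumE c x : \sum_(j < m) c * (X j x - mu) =
    c * (\sum_(j < m) X j x - m%:R * mu).
  by rewrite -mulr_sumr sumrB sumr_const card_ord -[mu *+ m]mulr_natl.
have mA : measurable A.
  rewrite -[A]setTI.
  have mD : measurable_fun setT (fun x => `|\sum_(j < m) X j x - m%:R * mu|).
    apply: measurableT_comp => //; apply: measurable_funB => //.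
    exact: measurable_sum.
  exact: (measurable_fun_ler mD (measurable_cst _) measurableT (Y := [set true])).
have CA : ~` A `<=` A1 `|` A2.
  move=> x /= /negP; rewrite -ltNge ltr_normr => /orP[h|h]; [left|right] => /=.
    by rewrite /A1 /= sumE ler_pM2l// ltW.
  by rewrite /A2 /= sumE mulNr -[- (s * _)]mulrN ler_pM2l// ltW.
have PCA : (P (~` A) <= (2 * expR (- ((2 + beta) * (9 / 8))))%:E)%E.
  apply: (@le_trans _ _ (P A1 + P A2)%E).
    apply: (@le_trans _ _ (P (A1 `|` A2))).
      apply: le_measure; [by rewrite inE; exact: measurableC| |exact: CA].
      by rewrite inE; apply: measurableU; exact: mAi.
    by apply: measureU2; exact: mAi.
  rewrite mulr2n mulrDl mul1r EFinD; apply: leeD.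
    by apply: (le_trans (exp_tail s _ BK)); rewrite lee_fin expo.
  by apply: (le_trans (exp_tail (- s) _ BK)); rewrite lee_fin expo// sqrrN.
(* The surplus exponent 9/4 + beta/8 absorbs the factor 2 of the union bound, since e^u >= 1 + u >
   2. *)
have small : 2 * expR (- ((2 + beta) * (9 / 8))) < expR (- beta).
  have -> : - ((2 + beta) * (9 / 8)) = - beta + - (9 / 4 + beta / 8) by lra.
  rewrite expRD mulrCA -[ltRHS]mulr1 ltr_pM2l ?expR_gt0//.
  rewrite expRN ltr_pdivrMr ?expR_gt0// mul1r.
  by have := @expR_ge1Dx R (9 / 4 + beta / 8); lra.
have -> : P A = (1 - P (~` A))%E.
  by rewrite -[in LHS](setCK A) probability_setC//; exact: measurableC.
have PAfin : P (~` A) \is a fin_num by rewrite fin_num_measure//; exact: measurableC.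
rewrite -(fineK PAfin) -EFinB lte_fin ltrD2l ltrN2.
by rewrite (le_lt_trans _ small)// -lee_fin fineK.
Qed.

End Independence.

(** * Measurability *)

Section GammaBar.
Variables (R : realType) (N : nat) (gam : 'I_N -> R -> R) (t : R).
Hypothesis gam_cont : forall i, {within `[0, t], continuous (gam i)}.

(** The rates are continuous on [[0, t]] only. Cut off to zero elsewhere they become measurable and
    bounded on the whole line, and sampled times, which lie in the simplex, do not see the
    change. *)
Definition restrict_rate (i : 'I_N) : R -> R := gam i \_ `[0, t].

Lemma restrict_rateE i s : 0 <= s <= t -> restrict_rate i s = gam i s.
Proof. by move=> s0t; rewrite /restrict_rate patchE mem_set //= in_itv. Qed.

Lemma measurable_restrict_rate i : measurable_fun setT (restrict_rate i).
Proof.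
apply/(measurable_restrictT _ _).1 => //.
apply: subspace_continuous_measurable_fun; first exact: measurable_itv.
exact: gam_cont.
Qed.

Hypothesis t_ge0 : 0 <= t.

Lemma gamma_bar_ub i s : 0 <= s <= t -> `|gam i s| <= gamma_bar gam t.
Proof.
move=> s0t; apply: ub_le_sup; last by exists (i, s).
(* The supremum is meaningful only for a bounded set: the extreme value theorem bounds each rate,
   and there are finitely many. *)
have /choice[K hK] : forall i, exists K : R, forall s, 0 <= s <= t -> `|gam i s| <= K.
  move=> k.
  have [c _ hc] := EVT_max t_ge0 (@gam_cont k).
  have [c' _ hc'] := EVT_min t_ge0 (@gam_cont k).
  exists (`|gam k c| + `|gam k c'|) => u u0t.
  have uI : u \in `[0, t] by rewrite in_itv.
  have h1 := hc _ uI; have h2 := hc' _ uI.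
  have h3 := ler_norm (gam k c); have h4 := lerNnormlW (lexx `|gam k c'|).
  have n3 := normr_ge0 (gam k c); have n4 := normr_ge0 (gam k c').
  by rewrite ler_norml; apply/andP; split; lra.
exists (\sum_k `|K k|) => _ [[k u] /= u0t <-].
rewrite (le_trans (hK _ _ u0t))// (le_trans (ler_norm _))//.
by rewrite (bigD1 k)//= lerDl; apply: sumr_ge0.
Qed.

Lemma restrict_rate_bound i s : 0 <= gamma_bar gam t ->
  `|restrict_rate i s| <= gamma_bar gam t.
Proof.
move=> g0; rewrite /restrict_rate patchE; case: ifPn => [|_].
  by rewrite inE /= in_itv /=; exact: gamma_bar_ub.
by rewrite normr0.
Qed.

End GammaBar.

Section BoundedMeasurable.
Context d0 (S : measurableType d0) (R : realType).
Local Notation C := R[i].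
Implicit Types F G : S -> C.

(** Measurability is by components because complex integrals are taken that way. The class is an
    algebra, so it contains the coefficients and the word expectations, and boundedness yields
    integrability on finite measures. *)
Definition bmeas F := [/\ measurable_fun setT (fun x => complex.Re (F x)),
  measurable_fun setT (fun x => complex.Im (F x)) &
  exists K, forall x, normc (F x) <= K].

Lemma bmeas_cst c : bmeas (fun=> c).
Proof. by split; [exact: measurable_cst|exact: measurable_cst|exists (normc c)]. Qed.

Lemma bmeasD F G : bmeas F -> bmeas G -> bmeas (fun x => F x + G x).
Proof.
move=> [mF mF' [K FK]] [mG mG' [K' GK]]; split.
- rewrite (_ : (fun x => _) =
      (fun x => complex.Re (F x)) \+ (fun x => complex.Re (G x))).
    exact: measurable_funD.
  by apply/funext => x /=; case: (F x) (G x) => [? ?] [].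
- rewrite (_ : (fun x => _) =
      (fun x => complex.Im (F x)) \+ (fun x => complex.Im (G x))).
    exact: measurable_funD.
  by apply/funext => x /=; case: (F x) (G x) => [? ?] [].
- by exists (K + K') => x; apply: (le_trans (le_normcD _ _)); exact: lerD.
Qed.

Lemma bmeasM F G : bmeas F -> bmeas G -> bmeas (fun x => F x * G x).
Proof.
move=> [mF mF' [K FK]] [mG mG' [K' GK]]; split.
- under eq_fun do rewrite ReM.
  by apply: measurable_funB; exact: measurable_funM.
- under eq_fun do rewrite ImM.
  by apply: measurable_funD; exact: measurable_funM.
- by exists (K * K') => x; rewrite normcM ler_pM ?normc_ge0.
Qed.

Lemma bmeas_sum (I : Type) (r : seq I) (P : pred I) (F : I -> S -> C) :
  (forall i, P i -> bmeas (F i)) -> bmeas (fun x => \sum_(i <- r | P i) F i x).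
Proof.
move=> bF; elim: r => [|i r IH].
  by under eq_fun do rewrite big_nil; exact: bmeas_cst.
under eq_fun do rewrite big_cons.
by case: (boolP (P i)) => // Pi; apply: bmeasD => //; exact: bF.
Qed.

Lemma bmeas_prod (I : Type) (r : seq I) (P : pred I) (F : I -> S -> C) :
  (forall i, P i -> bmeas (F i)) -> bmeas (fun x => \prod_(i <- r | P i) F i x).
Proof.
move=> bF; elim: r => [|i r IH].
  by under eq_fun do rewrite big_nil; exact: bmeas_cst.
under eq_fun do rewrite big_cons.
by case: (boolP (P i)) => // Pi; apply: bmeasM => //; exact: bF.
Qed.

Lemma bmeas_real (f : S -> R) (K : R) : measurable_fun setT f ->
  (forall x, `|f x| <= K) -> bmeas (fun x => (f x)%:C).
Proof.
move=> mf fK; split; [exact: mf|exact: measurable_cst|].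
by exists K => x; rewrite normc_real.
Qed.

Lemma bmeas_expi (f : S -> R) : measurable_fun setT f ->
  bmeas (fun x => expi (f x)).
Proof.
move=> mf; split => /=.
- apply: measurableT_comp => //; apply: continuous_measurable_fun.
  exact: continuous_cos.
- apply: measurableT_comp => //; apply: continuous_measurable_fun.
  exact: continuous_sin.
- by exists 1 => x; rewrite /= cos2Dsin2 sqrtr1.
Qed.

Variable d : nat.
Implicit Types A B : S -> 'M[C]_d.

Definition bmeas_mx A := forall i j, bmeas (fun x => A x i j).

Lemma bmeas_mulmx A B : bmeas_mx A -> bmeas_mx B -> bmeas_mx (fun x => A x *m B x).
Proof.
move=> bA bB i j; under eq_fun do rewrite mxE.
by apply: bmeas_sum => k _; exact: bmeasM.
Qed.

Lemma bmeas_trace A : bmeas_mx A -> bmeas (fun x => \tr (A x)).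
Proof. by move=> bA; apply: bmeas_sum => k _; exact: bA. Qed.

Variable H : 'M[C]_d.
Hypothesis H_herm : H \is hermsymmx.

Lemma bmeas_evolve (f : S -> R) (X : 'M[C]_d) : measurable_fun setT f ->
  bmeas_mx (fun x => evolve H (f x) X).
Proof.
move=> mf; have [V [_ _ _ VE [e [c Ve]]]] := evolve_unitary_group H_herm.
have bV (g : S -> R) : measurable_fun setT g -> bmeas_mx (fun x => V (g x)).
  move=> mg i j; under eq_fun do rewrite Ve.
  apply: bmeas_sum => l _; apply: bmeasM; first exact: bmeas_cst.
  by apply: bmeas_expi; exact: measurable_funM.
rewrite (_ : (fun x => _) = (fun x => V (f x) *m X *m V (- f x))); last first.
  by apply/funext => x; exact: VE.
apply: bmeas_mulmx; last by apply: bV; exact: measurable_funN.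
by apply: bmeas_mulmx; [exact: bV|move=> i j; exact: bmeas_cst].
Qed.

Variable Q : 'I_(d ^ 2) -> 'M[C]_d.

(** The starting matrix may depend on the point, as it does after the first letter of the word has
    been absorbed in the induction. *)
Lemma bmeas_foldl_word n (c : n.-tuple (branch d)) (f : S -> n.-tuple R)
    (X : S -> 'M[C]_d) :
  (forall j, measurable_fun setT (fun x => tnth (f x) j)) -> bmeas_mx X ->
  bmeas_mx (fun x => foldl (branch_word H Q) (X x) (zip c (f x))).
Proof.
elim: n c f X => [|n IH] c f X mf bX.
  have -> // : (fun x => foldl (branch_word H Q) (X x) (zip c (f x))) = X.
  by apply/funext => x; rewrite [c]tuple0 [f x]tuple0.
case/tupleP: c => b c.
rewrite (_ : (fun x => _) = (fun x => foldl (branch_word H Q)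
    (branch_word H Q (X x) (b, tnth (f x) ord0)) (zip c (behead_tuple (f x))))).
  apply: IH => [j|].
    rewrite (_ : (fun x => _) = (fun x => tnth (f x) (lift ord0 j))); first exact: mf.
    by apply/funext => x; rewrite [in RHS](tuple_eta (f x)) tnthS.
  case: b => -[b k] k'; rewrite /branch_word.
  have bk k0 := bmeas_evolve (Q k0) (mf ord0).
  case: (val b) => [|[|_]].
  - by apply: bmeas_mulmx => //; apply: bmeas_mulmx => //; exact: bk.
  - by apply: bmeas_mulmx => //; apply: bmeas_mulmx => //; exact: bk.
  - by apply: bmeas_mulmx => //; apply: bmeas_mulmx => //; exact: bk.
by apply/funext => x; rewrite [in LHS](tuple_eta (f x)).
Qed.

End BoundedMeasurable.

Section MeanTerms.
Variables (R : realType) (d N n : nat) (t : R).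
Local Notation C := R[i].
Variables (H rho : 'M[C]_d) (Q : 'I_(d ^ 2) -> 'M[C]_d).
Hypothesis H_herm : H \is hermsymmx.

Lemma bmeas_expect_word (a : term_index d n) :
  bmeas (fun s : n.-tuple R => expect rho (word H Q t s a)).
Proof.
rewrite /expect; apply: bmeas_trace; apply: bmeas_mulmx; last first.
  by move=> i j; exact: bmeas_cst.
apply: (bmeas_foldl_word H_herm) => [j|i j]; last exact: bmeas_cst.
exact: measurable_tnth.
Qed.

Variables (q : 'I_N -> 'I_(d ^ 2) -> C) (qO : 'I_(d ^ 2) -> C).
Variables (gam : 'I_N -> R -> R) (G : R).
Hypothesis gam_meas : forall i, measurable_fun setT (gam i).
Hypothesis gam_bound : forall i s, `|gam i s| <= G.

Lemma bmeas_coef (w : n.-tuple 'I_N) (a : term_index d n) :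
  bmeas (fun s => coef q qO gam w s a).
Proof.
apply: bmeasM; first exact: bmeas_cst.
apply: bmeas_prod => j _.
apply: bmeasM; last exact: bmeas_cst.
apply: bmeasM; last exact: bmeas_cst.
apply: bmeasM; last exact: bmeas_cst.
apply: (@bmeas_real _ _ _ _ G) => //.
by apply: measurableT_comp => //; exact: measurable_tnth.
Qed.

End MeanTerms.

(** * Mean of a single-shot outcome *)

Section RintegralSum.
Context d (T : measurableType d) (R : realType).
Variables (mu : {measure set T -> \bar R}) (D : set T).
Hypothesis mD : measurable D.

Lemma integrable_big_sum (I : Type) (r : seq I) (P : pred I) (f : I -> T -> R) :
  (forall i, P i -> mu.-integrable D (EFin \o f i)) ->
  mu.-integrable D (EFin \o (fun x => \sum_(i <- r | P i) f i x)).
Proof.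
move=> fi; have := integrable_sum (mu := mu) (D := D) mD r fi.
apply: eq_integrable => // x _ /=.
by rewrite (big_morph EFin EFinD erefl).
Qed.

Lemma Rintegral_sum (I : Type) (r : seq I) (P : pred I) (f : I -> T -> R) :
  (forall i, P i -> mu.-integrable D (EFin \o f i)) ->
  \int[mu]_(x in D) (\sum_(i <- r | P i) f i x) =
  \sum_(i <- r | P i) \int[mu]_(x in D) f i x.
Proof.
move=> fi; elim: r => [|i r IH].
  under eq_Rintegral do rewrite big_nil.
  by rewrite Rintegral_cst// mul0r big_nil.
under eq_Rintegral do rewrite big_cons.
rewrite big_cons; case: (boolP (P i)) => // Pi.
by rewrite RintegralD// ?IH//; [exact: fi|exact: integrable_big_sum].
Qed.

End RintegralSum.

Section ATildeMeasurable.
Variables (R : realType) (d N n : nat).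
Local Notation C := R[i].
Variables (supp : 'I_N -> {set 'I_(d ^ 2)}) (q : 'I_N -> 'I_(d ^ 2) -> C).
Variables (suppO : {set 'I_(d ^ 2)}) (qO : 'I_(d ^ 2) -> C).
Variables (gam : 'I_N -> R -> R) (G : R).
Hypothesis gam_meas : forall i, measurable_fun setT (gam i).
Hypothesis gam_bound : forall i s, `|gam i s| <= G.

Definition shot_term (w : n.-tuple 'I_N) (a : term_index d n) (s : n.-tuple R)
    (lr li : R) : R :=
  complex.Re (coef q qO gam w s a) * lr - complex.Im (coef q qO gam w s a) * li.

(** Splitting along the finitely many values of [w] fixes the index tuple in each term, so that
    coefficients become functions of the times alone. *)
Lemma A_tilde_fibers (T : Type) (w : T -> n.-tuple 'I_N) (s : T -> n.-tuple R)
    (lamr lami : term_index d n -> T -> R) x :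
  A_tilde supp q suppO qO gam (w x) (s x) (lamr ^~ x) (lami ^~ x) =
  \sum_w0 \sum_(a | term_of supp suppO w0 a)
    \1_(w @^-1` [set w0]) x * shot_term w0 a (s x) (lamr a x) (lami a x).
Proof.
rewrite (bigD1 (w x))//= [X in _ + X]big1 => [|w0 w0x]; last first.
  rewrite big1// => a _; rewrite indicE memNset ?mul0r//= => wx.
  by rewrite wx eqxx in w0x.
rewrite addr0; apply: eq_bigr => a _.
by rewrite indicE mem_set//= mul1r ReM.
Qed.

Lemma measurable_A_tilde d0 (T : measurableType d0) (w : T -> n.-tuple 'I_N)
    (s : T -> n.-tuple R) (lamr lami : term_index d n -> T -> R) :
  (forall w0, measurable (w @^-1` [set w0])) -> measurable_fun setT s ->
  (forall a, measurable_fun setT (lamr a) /\ measurable_fun setT (lami a)) ->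
  measurable_fun setT (fun x =>
    A_tilde supp q suppO qO gam (w x) (s x) (lamr ^~ x) (lami ^~ x)).
Proof.
move=> mw ms ml; under eq_fun do rewrite A_tilde_fibers.
apply: measurable_sum => w0; under eq_fun do rewrite big_mkcond.
apply: measurable_sum => a; case: (term_of _ _ _ _); last exact: measurable_cst.
have [m1 m2 _] := bmeas_coef q qO gam_meas gam_bound w0 a.
apply: measurable_funM; first exact: measurable_indic.
apply: measurable_funB.
  by apply: measurable_funM; [exact: (measurableT_comp m1)|exact: (ml a).1].
by apply: measurable_funM; [exact: (measurableT_comp m2)|exact: (ml a).2].
Qed.

(** [measurable_A_tilde] is applied to [T] equipped with the sigma-algebra generated by the shot,
    for which [w], [s] and the outcomes are measurable by construction. *)
Lemma shot_sigma_A_tilde d0 (T : measurableType d0) (w : T -> n.-tuple 'I_N)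
    (s : T -> n.-tuple R) (lamr lami : term_index d n -> T -> R) (B : set R) :
  measurable B ->
  shot_sigma w s lamr lami ((fun x =>
    A_tilde supp q suppO qO gam (w x) (s x) (lamr ^~ x) (lami ^~ x)) @^-1` B).
Proof.
move=> mB; rewrite /shot_sigma; set gens := (X in <<s X >>).
have gen E : gens E -> (measurable : set (set (g_sigma_algebraType gens))) E.
  exact: sub_sigma_algebra.
have := @measurable_A_tilde _ (g_sigma_algebraType gens) w s lamr lami.
move=> /(_ _ _ _ measurableT B mB); rewrite setTI; apply.
- by move=> w0; apply: gen; apply: Or41; exists w0.
- by move=> _ Y mY; rewrite setTI; apply: gen; apply: Or42; exists Y.
- move=> a; split=> _ Y mY; rewrite setTI; apply: gen.
    by apply: Or43; exists a; exists Y.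
  by apply: Or44; exists a; exists Y.
Qed.

End ATildeMeasurable.

Section ShotMean.
Variables (R : realType) (d N n : nat) (t : R).
Local Notation C := R[i].
Hypothesis t_gt0 : 0 < t.
Context (dT : measure_display) (T : measurableType dT) (P : probability T R).
Variables (w : T -> n.-tuple 'I_N) (s : T -> n.-tuple R).
Hypothesis unif : uniform_pair P t w s.

Definition uniform_density : R := (N ^ n)%:R^-1 / (t ^+ n / n`!%:R).

Let mw w0 : measurable (w @^-1` [set w0]).
Proof. by case: unif. Qed.

Let ms : measurable_fun setT s.
Proof. by case: unif. Qed.

Let volE : lebesgue_tuple R n (simplex t n) = (t ^+ n / n`!%:R)%:E.
Proof. by rewrite lebesgue_tuple_simplex// ltW. Qed.

Let msimplex : measurable (simplex t n : set (n.-tuple R)).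
Proof. exact: measurable_simplex. Qed.

Lemma simplex_integrable (F : n.-tuple R -> R) (K : R) :
  measurable_fun setT F -> (forall y, `|F y| <= K) ->
  (lebesgue_tuple R n).-integrable (simplex t n) (EFin \o F).
Proof.
move=> mF FK; apply: measurable_bounded_integrable => //.
- by have /= -> := volE; rewrite ltry.
- exact: (measurable_funS measurableT).
exists K; split; first exact: num_real.
by move=> x Kx y _; exact: le_trans (FK y) (ltW Kx).
Qed.

(** On the event [w = w0] the law of [s] is Lebesgue measure on the simplex with constant density.
    The transfer needs nonnegative functions, hence the shift of [F] by its bound. *)
Lemma uniform_Rintegral (F : n.-tuple R -> R) (K : R) w0 :
  measurable_fun setT F -> (forall y, `|F y| <= K) ->
  \int[P]_(x in w @^-1` [set w0]) F (s x) =
  uniform_density * \int[lebesgue_tuple R n]_(y in simplex t n) F y.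
Proof.
move=> mF FK; case: (unif) => _ _ _ unifE.
set E := w @^-1` [set w0].
have kap0 : 0 <= uniform_density.
  by rewrite divr_ge0 ?invr_ge0// divr_ge0// exprn_ge0// ltW.
have massE B : measurable B -> P (E `&` s @^-1` B) =
    (uniform_density%:E * lebesgue_tuple R n (simplex t n `&` B))%E.
  move=> mB; rewrite unifE//; have /= -> := volE.
  have fin : lebesgue_tuple R n (simplex t n `&` B) \is a fin_num.
    rewrite ge0_fin_numE//; apply: (@le_lt_trans _ _ (lebesgue_tuple R n (simplex t n))).
      by apply: le_measure; rewrite ?inE//; exact: measurableI.
    by have /= -> := volE; rewrite ltry.
  rewrite -[in RHS](fineK fin) -EFinM; congr EFin.
  by rewrite /uniform_density /=; ring.
have key : (\int[P]_(x in E) ((F (s x) + K) * 1)%:E =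
    \int[lebesgue_tuple R n]_(y in simplex t n) ((F y + K) * uniform_density)%:E)%E.
  apply: (@ge0_integral_transfer _ _ _ _ _ _ _ s E id (simplex t n) P
    (lebesgue_tuple R n) (cst 1) (cst uniform_density) (fun y => F y + K)) => //.
  - exact: mw.
  - exact: measurable_funD.
  - by move=> y; have := FK y; rewrite ler_norml; lra.
  move=> B mB; rewrite preimage_id.
  have mEB : measurable (E `&` s @^-1` B).
    apply: measurableI; first exact: mw.
    by rewrite -[X in measurable X]setTI; exact: ms.
  have mVB : measurable (simplex t n `&` B) by exact: measurableI.
  have -> := integral_cst P mEB 1%:E; rewrite mul1e.
  by have -> := integral_cst (lebesgue_tuple R n) mVB uniform_density%:E; exact: massE.
have iF : P.-integrable E (EFin \o (fun x => F (s x))).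
  apply: (@bounded_integrable _ _ _ P _ _ K) => //; first exact: mw.
  by apply: (measurable_funS measurableT) => //; exact: measurableT_comp.
have ic (c : R) : P.-integrable E (EFin \o (fun=> c)).
  by apply: (@bounded_integrable _ _ _ P _ _ `|c|) => //; exact: mw.
have := congr1 fine key; rewrite -!/(Rintegral _ _ _).
under eq_Rintegral do rewrite mulr1.
rewrite RintegralD//; last exact: mw.
rewrite RintegralZr//; last first.
  apply: (@simplex_integrable (fun y => F y + K) (K + K)).
    exact: measurable_funD.
  move=> y; have K0 : 0 <= K := le_trans (normr_ge0 _) (FK y).
  by rewrite (le_trans (ler_normD _ _))// lerD// ger0_norm.
rewrite RintegralD//; [|exact: (simplex_integrable mF FK)|]; last first.
  exact: (@simplex_integrable (fun=> K) `|K|).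
rewrite !Rintegral_cst//; last exact: mw.
have fV : fine (lebesgue_tuple R n (simplex t n)) = t ^+ n / n`!%:R by rewrite volE.
have fP : fine (P E) = uniform_density * (t ^+ n / n`!%:R).
  have := massE setT measurableT; rewrite preimage_setT !setIT => ->.
  by rewrite volE.
(* The shift contributes K times the probability of [E] on one side and K times density times volume
   on the other; these are equal and cancel. *)
move=> h; apply: (addIr (K * (uniform_density * (t ^+ n / n`!%:R)))).
rewrite -[X in _ + K * X = _]fP; apply: (etrans h).
by rewrite [X in K * X]fV; ring.
Qed.

Variables (H rho : 'M[C]_d) (Q : 'I_(d ^ 2) -> 'M[C]_d).
Hypothesis H_herm : H \is hermsymmx.
Variables (supp : 'I_N -> {set 'I_(d ^ 2)}) (q : 'I_N -> 'I_(d ^ 2) -> C).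
Variables (suppO : {set 'I_(d ^ 2)}) (qO : 'I_(d ^ 2) -> C).
Variables (gam : 'I_N -> R -> R) (G : R).
Hypothesis gam_meas : forall i, measurable_fun setT (gam i).
Hypothesis gam_bound : forall i s, `|gam i s| <= G.
Variables (lamr lami : term_index d n -> T -> R).
Hypothesis shots : single_shot P H rho Q supp suppO t w s lamr lami.

Lemma normr_Re_bmeas d0 (S : measurableType d0) (F : S -> C) : bmeas F ->
  exists K, forall x, `|complex.Re (F x)| <= K /\ `|complex.Im (F x)| <= K.
Proof.
move=> [_ _ [K FK]]; exists K => x; split.
  exact: le_trans (ler_Re_normc _) (FK x).
(* The imaginary part is, up to sign, the real part after multiplication by i, which preserves the
   modulus. *)
apply: le_trans (FK x); have := ler_Re_normc (F x * 'i%C).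
rewrite normcM; case: (F x) => a b /=.
by rewrite expr0n expr1n add0r sqrtr1 !mulr1 mulr0 sub0r normrN.
Qed.

Let meanW a (y : n.-tuple R) := expect rho (word H Q t y a).

(** On the fiber over [w0] the transfer replaces each outcome, weighted by a function of the times,
    by its conditional mean. The two weighted means recombine into the real part of c_a <W_a>, to
    which the uniform law applies. *)
Lemma shot_term_mean w0 a : term_of supp suppO w0 a ->
  P.-integrable setT (EFin \o (fun x => \1_(w @^-1` [set w0]) x *
    shot_term q qO gam w0 a (s x) (lamr a x) (lami a x))) /\
  \int[P]_x (\1_(w @^-1` [set w0]) x *
    shot_term q qO gam w0 a (s x) (lamr a x) (lami a x)) =
  uniform_density * \int[lebesgue_tuple R n]_(y in simplex t n)
    complex.Re (coef q qO gam w0 y a * meanW a y).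
Proof.
move=> aw; case: shots => ml lam1 lamE.
set E := w @^-1` [set w0].
have bc := bmeas_coef q qO gam_meas gam_bound w0 a.
have bW := bmeas_expect_word t rho Q H_herm a.
have [K1 hK1] := normr_Re_bmeas bc.
have [K2 hK2] := normr_Re_bmeas bW.
have [mc1 mc2 _] := bc; have [mW1 mW2 _] := bW.
pose c1 y := complex.Re (coef q qO gam w0 y a).
pose c2 y := complex.Im (coef q qO gam w0 y a).
have lam_le x : E x -> `|lamr a x| <= 1 /\ `|lami a x| <= 1.
  move=> Ex; have aw' : term_of supp suppO (w x) a by rewrite Ex.
  have [h1 h2] := lam1 x a aw'.
  by split; [case: h1 => ->|case: h2 => ->]; rewrite ?normrN normr1.
have mE : measurable E := mw w0.
have [mlr mli] := ml a.
have mcs1 : measurable_fun setT (fun x => c1 (s x)) := measurableT_comp mc1 ms.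
have mcs2 : measurable_fun setT (fun x => c2 (s x)) := measurableT_comp mc2 ms.
have i1 : P.-integrable E (EFin \o (fun x => c1 (s x) * lamr a x)).
  apply: (@bounded_integrable _ _ _ P _ _ (K1 * 1)) => //.
    by apply: (measurable_funS measurableT) => //; exact: measurable_funM.
  move=> x Ex; rewrite normrM ler_pM//; first exact: (hK1 _).1.
  exact: (lam_le x Ex).1.
have i2 : P.-integrable E (EFin \o (fun x => c2 (s x) * lami a x)).
  apply: (@bounded_integrable _ _ _ P _ _ (K1 * 1)) => //.
    by apply: (measurable_funS measurableT) => //; exact: measurable_funM.
  move=> x Ex; rewrite normrM ler_pM//; first exact: (hK1 _).2.
  exact: (lam_le x Ex).2.
(* The transfer takes a single bound for the outcomes, their conditional means and the
   coefficients. *)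
pose K := Num.max 1 (Num.max K1 K2).
have leK x : x <= 1 \/ x <= K1 \/ x <= K2 -> x <= K.
  by rewrite /K !le_max => -[->|[->|->]]; rewrite ?orbT.
have tr1 : \int[P]_(x in E) (c1 (s x) * lamr a x) =
    \int[P]_(x in E) (c1 (s x) * complex.Re (meanW a (s x))).
  apply: (@Rintegral_transfer _ _ _ _ _ s E ms mE P (lamr a)
    (fun x => complex.Re (meanW a (s x))) c1 K) => //.
  - by move=> x Ex; apply: leK; left; exact: (lam_le x Ex).1.
  - exact: measurableT_comp mW1 ms.
  - by move=> x _; apply: leK; right; right; exact: (hK2 _).1.
  - by move=> y; apply: leK; right; left; exact: (hK1 _).1.
  - by move=> B mB; exact: (lamE w0 a B aw mB).1.
have tr2 : \int[P]_(x in E) (c2 (s x) * lami a x) =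
    \int[P]_(x in E) (c2 (s x) * complex.Im (meanW a (s x))).
  apply: (@Rintegral_transfer _ _ _ _ _ s E ms mE P (lami a)
    (fun x => complex.Im (meanW a (s x))) c2 K) => //.
  - by move=> x Ex; apply: leK; left; exact: (lam_le x Ex).2.
  - exact: measurableT_comp mW2 ms.
  - by move=> x _; apply: leK; right; right; exact: (hK2 _).2.
  - by move=> y; apply: leK; right; left; exact: (hK1 _).2.
  - by move=> B mB; exact: (lamE w0 a B aw mB).2.
have indE (f : T -> R) : (fun x => \1_E x * f x) = f \_ E.
  apply/funext => x; rewrite patchE indicE.
  by case: (x \in E); rewrite ?mul1r ?mul0r.
split.
  rewrite indE -restrict_EFin; apply/integrable_restrict => //.
  by rewrite setTI; have := integrableB mE i1 i2; exact.
rewrite indE -Rintegral_mkcond RintegralB// tr1 tr2.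
have j1 : P.-integrable E (EFin \o (fun x => c1 (s x) * complex.Re (meanW a (s x)))).
  apply: (@bounded_integrable _ _ _ P _ _ (K1 * K2)) => //.
    apply: (measurable_funS measurableT) => //; apply: measurable_funM => //.
    exact: measurableT_comp mW1 ms.
  move=> x Ex; rewrite normrM ler_pM//; first exact: (hK1 _).1.
  exact: (hK2 _).1.
have j2 : P.-integrable E (EFin \o (fun x => c2 (s x) * complex.Im (meanW a (s x)))).
  apply: (@bounded_integrable _ _ _ P _ _ (K1 * K2)) => //.
    apply: (measurable_funS measurableT) => //; apply: measurable_funM => //.
    exact: measurableT_comp mW2 ms.
  move=> x Ex; rewrite normrM ler_pM//; first exact: (hK1 _).2.
  exact: (hK2 _).2.
rewrite -RintegralB//.
have bcW := bmeasM bc bW; have [K3 hK3] := normr_Re_bmeas bcW.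
have [m3 _ _] := bcW.
rewrite -(uniform_Rintegral w0 m3 (fun y => (hK3 y).1)).
by apply: eq_Rintegral => x _; rewrite ReM.
Qed.

Lemma A_tilde_mean :
  \int[P]_x A_tilde supp q suppO qO gam (w x) (s x) (lamr ^~ x) (lami ^~ x) =
  uniform_density * \sum_(w0 : n.-tuple 'I_N)
    \int[lebesgue_tuple R n]_(y in simplex t n) complex.Re
      (\sum_(a | term_of supp suppO w0 a) coef q qO gam w0 y a * meanW a y).
Proof.
under eq_Rintegral do rewrite A_tilde_fibers.
rewrite Rintegral_sum//; last first.
  move=> w0 _; apply: integrable_big_sum => // a aw.
  exact: (shot_term_mean aw).1.
rewrite big_distrr/=; apply: eq_bigr => w0 _.
rewrite Rintegral_sum//; last by move=> a aw; exact: (shot_term_mean aw).1.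
under [in RHS]eq_Rintegral do rewrite Re_sum.
rewrite Rintegral_sum//; last first.
  move=> a aw.
  have bcW := bmeasM (bmeas_coef q qO gam_meas gam_bound w0 a)
    (bmeas_expect_word t rho Q H_herm a).
  have [K3 hK3] := normr_Re_bmeas bcW; have [m3 _ _] := bcW.
  exact: (simplex_integrable m3 (fun y => (hK3 y).1)).
rewrite big_distrr/=; apply: eq_bigr => a aw.
exact: (shot_term_mean aw).2.
Qed.

End ShotMean.

(** * Conclusion *)

Lemma A_rec_eq_rate (R : realType) d N (H : 'M[R[i]]_d) (L : 'I_N -> 'M[R[i]]_d)
    (gam gam' : 'I_N -> R -> R) r X l :
  (forall p, p \in l -> gam p.1 p.2 = gam' p.1 p.2) ->
  A_rec H L gam r X l = A_rec H L gam' r X l.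
Proof.
elim: l r X => [|[i s] l IH] r X gE //=.
rewrite (gE (i, s)) ?mem_head//; apply: IH => p pl.
by apply: gE; rewrite inE pl orbT.
Qed.

Lemma A_op_restrict_rate (R : realType) d N n (H : 'M[R[i]]_d)
    (L : 'I_N -> 'M[R[i]]_d) (O : 'M[R[i]]_d) (gam : 'I_N -> R -> R) (t : R)
    (w : n.-tuple 'I_N) (s : n.-tuple R) :
  simplex t n s -> A_op H L O gam t w s = A_op H L O (restrict_rate gam t) t w s.
Proof.
move=> /simplex_tnth s0t; apply: A_rec_eq_rate => -[i u] iu.
rewrite /= restrict_rateE//.
have /tnthP[j ->] : u \in s; last exact: s0t.
have : (i, u).2 \in unzip2 (zip w s) by exact: map_f.
by rewrite unzip2_zip ?size_tuple.
Qed.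

Lemma A_tilde_restrict_rate (R : realType) d N n
    (supp : 'I_N -> {set 'I_(d ^ 2)}) (q : 'I_N -> 'I_(d ^ 2) -> R[i])
    (suppO : {set 'I_(d ^ 2)}) (qO : 'I_(d ^ 2) -> R[i])
    (gam : 'I_N -> R -> R) (t : R) (w : n.-tuple 'I_N) (s : n.-tuple R) lamr lami :
  simplex t n s ->
  A_tilde supp q suppO qO gam w s lamr lami =
  A_tilde supp q suppO qO (restrict_rate gam t) w s lamr lami.
Proof.
move=> /simplex_tnth s0t; apply: eq_bigr => a _; congr (complex.Re (_ * _)).
by congr (_ * _); apply: eq_bigr => j _; rewrite restrict_rateE.
Qed.

Unset Implicit Arguments.
Set Strict Implicit.

Theorem mainTheorem1
    (R : realType) (d N n : nat) (t beta delta : R)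
    (n_ge1 : (1 <= n)%N) (t_gt0 : 0 < t) (beta_gt0 : 0 < beta)
    (delta_gt0 : 0 < delta)
    (H : 'M[R[i]]_d) (L : 'I_N -> 'M[R[i]]_d) (O : 'M[R[i]]_d)
    (gam : 'I_N -> R -> R) (rho : 'M[R[i]]_d)
    (H_herm : H \is hermsymmx)
    (L_norm : forall i, opnorm (L i) = 1)
    (O_herm : O \is hermsymmx) (O_norm : opnorm O = 1)
    (gam_cont : forall i, {within `[0, t], continuous (gam i)})
    (rho_density : density_operator rho)
    (* decompositions in a Pauli-kind basis *)
    (Q : 'I_(d ^ 2) -> 'M[R[i]]_d) (Q_basis : pauli_kind_basis Q)
    (supp : 'I_N -> {set 'I_(d ^ 2)}) (q : 'I_N -> 'I_(d ^ 2) -> R[i])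
    (suppO : {set 'I_(d ^ 2)}) (qO : 'I_(d ^ 2) -> R[i])
    (L_dec : forall i, L i = \sum_(k in supp i) q i k *: Q k)
    (O_dec : O = \sum_(l in suppO) qO l *: Q l)
    (* m sampled pairs [ws j, ts j], each with its single-shot outcomes *)
    (dT : measure_display) (T : measurableType dT) (P : probability T R)
    (m : nat) (m_ge1 : (1 <= m)%N)
    (ws : 'I_m -> T -> n.-tuple 'I_N) (ts : 'I_m -> T -> n.-tuple R)
    (lamr lami : 'I_m -> term_index d n -> T -> R)
    (ws_ts_unif : forall j, uniform_pair P t (ws j) (ts j))
    (shots : forall j,
       single_shot P H rho Q supp suppO t (ws j) (ts j) (lamr j) (lami j))
    (shots_indep : independent_sigmas P
       (fun j => shot_sigma (ws j) (ts j) (lamr j) (lami j))) :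
  let M := (\max_(i < N) #|supp i|)%N in
  let MO := #|suppO| in
  let target : R[i] :=
    \sum_(w : n.-tuple 'I_N)
      simplex_cintegral t (fun s => expect rho (A_op H L O gam t w s)) in
  let estimate (x : T) : R :=
    (N%:R * t) ^+ n / (n`!%:R * m%:R)
    * \sum_(j < m) A_tilde supp q suppO qO gam (ws j x) (ts j x)
                           (lamr j ^~ x) (lami j ^~ x) in
  36 * MO%:R ^+ 2 * (2 + beta) / delta ^+ 2
    * ((2 * gamma_bar gam t * M%:R * N%:R * t) ^+ (2 * n) / n`!%:R ^+ 2)
    < m%:R ->
  ((1 - expR (- beta))%:E
   < P [set x | (`|target - (estimate x)%:C| <= delta%:C)%R])%E.
Proof.
move=> M MO target estimate hm.
have t_ge0 : 0 <= t := ltW t_gt0.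
have Q_herm k : Q k \is hermsymmx by case: (Q_basis.1 k).
(* A probability space is inhabited, and since [m] and [n] are positive any sample point yields an
   index in ['I_N]; thus [N] is positive and can be divided by. *)
have [x0 _] : [set: T] !=set0.
  apply/set0P/eqP => T0; have := probability_setT P.
  by rewrite T0 measure0 => /eqP; rewrite eq_sym onee_eq0.
have i0 : 'I_N := tnth (ws (Ordinal m_ge1) x0) (Ordinal n_ge1).
have N_gt0 : (0 < N)%N by case: i0 => k; case: (N).
set gr := restrict_rate gam t.
set G := gamma_bar gam t.
have G_ge0 : 0 <= G.
  apply: le_trans (gamma_bar_ub gam_cont t_ge0 i0 (s := 0) _); first exact: normr_ge0.
  by rewrite lexx.
have gr_meas i : measurable_fun setT (gr i) by exact: measurable_restrict_rate.
have gr_bound i s : `|gr i s| <= G by exact: restrict_rate_bound.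
pose X j x := A_tilde supp q suppO qO gr (ws j x) (ts j x) (lamr j ^~ x) (lami j ^~ x).
have ts_simplex j x : simplex t n (ts j x) by case: (ws_ts_unif j).
have XE j x : A_tilde supp q suppO qO gam (ws j x) (ts j x)
    (lamr j ^~ x) (lami j ^~ x) = X j x.
  exact: A_tilde_restrict_rate.
have mX j : measurable_fun setT (X j).
  have [mw ms _ _] := ws_ts_unif j; have [ml _ _] := shots j.
  exact: (measurable_A_tilde supp q suppO qO gr_meas gr_bound mw ms ml).
have X_indep (B : 'I_m -> set R) : (forall j, measurable (B j)) ->
    P (\bigcap_j (X j @^-1` B j)) = (\prod_(j < m) P (X j @^-1` B j))%E.
  move=> mB; apply: shots_indep => j.
  exact: (shot_sigma_A_tilde supp q suppO qO gr_meas gr_bound).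
pose B : R := Num.sqrt 2 * (MO%:R * (2 * G * M%:R) ^+ n).
have X_bound j x : `|X j x| <= B.
  apply: A_tilde_bound => [i| | |a aw].
  - apply: le_trans (pauli_sqr_sum_le Q_basis (L_dec i) (L_norm i)) _.
    by rewrite ler_nat; apply: (leq_bigmax_cond (F := fun i => #|supp i|)).
  - by have := pauli_sum_le Q_basis O_dec O_norm.
  - by move=> k; exact: gr_bound.
  - by have [_ h _] := shots j; exact: h.
pose S := \sum_(w0 : n.-tuple 'I_N) \int[lebesgue_tuple R n]_(y in simplex t n)
  complex.Re (expect rho (A_op H L O gam t w0 y)).
pose mu := uniform_density N n t * S.
have X_mean j : \int[P]_x X j x = mu.
  rewrite (A_tilde_mean t_gt0 (ws_ts_unif j) H_herm q qO gr_meas gr_bound (shots j)).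
  congr (_ * _); apply: eq_bigr => w0 _; apply: eq_Rintegral => y.
  rewrite inE => ys; rewrite A_op_restrict_rate//.
  by rewrite (expect_A_op gr t H_herm Q_herm L_dec O_dec).
have [rho_herm _ _] := rho_density.
have targetE : target = S%:C.
  rewrite /target /S rmorph_sum /=; apply: eq_bigr => w0 _.
  rewrite /simplex_cintegral; congr Complex.
  rewrite (@eq_Rintegral _ _ _ _ _ (fun=> 0)); last first.
    move=> y _; apply: Im_expect_adjoint; first exact: hermsymmx_adjoint.
    by apply: A_op_adjoint => //; exact: hermsymmx_adjoint.
  by rewrite Rintegral_cst ?mul0r//; exact: measurable_simplex.
have m_gt0 : 0 < m%:R :> R by rewrite ltr0n.
have Nt_gt0 : 0 < (N%:R * t) ^+ n by rewrite exprn_gt0// mulr_gt0// ltr0n.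
have nf_gt0 : 0 < n`!%:R :> R by rewrite ltr0n fact_gt0.
pose eps := delta * n`!%:R / (N%:R * t) ^+ n.
have eps_gt0 : 0 < eps by rewrite divr_gt0// mulr_gt0.
(* Both events are the same after division by the positive normalization (N t)^n / (n! m), which
   takes [delta] to [m%:R * eps] and the target to [m%:R * mu]. *)
have -> : [set x | `|target - (estimate x)%:C| <= delta%:C] =
    [set x | `|\sum_(j < m) X j x - m%:R * mu| <= m%:R * eps].
  apply/funext => x; apply/propext => /=.
  rewrite targetE -rmorphB /= normc_def /= expr0n /= addr0 sqrtr_sqr lecR.
  have -> : S - estimate x = - ((N%:R * t) ^+ n / (n`!%:R * m%:R)
      * (\sum_(j < m) X j x - m%:R * mu)).
    rewrite /estimate; under eq_bigr do rewrite XE.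
    rewrite /mu /uniform_density natrX exprMn; field.
    by rewrite !gt_eqF// ?exprn_gt0// ltr0n.
  have c_gt0 : 0 < (N%:R * t) ^+ n / (n`!%:R * m%:R) :> R.
    by rewrite divr_gt0// mulr_gt0.
  rewrite normrN normrM (gtr0_norm c_gt0) -ler_pdivlMl//.
  have -> // : ((N%:R * t) ^+ n / (n`!%:R * m%:R))^-1 * delta = m%:R * eps.
  rewrite /eps; field.
  by rewrite !gt_eqF// -?exprMn.
apply: (hoeffding mX X_indep X_bound X_mean m_ge1 eps_gt0 beta_gt0).
  by rewrite mulr_ge0 ?sqrtr_ge0// mulr_ge0// exprn_ge0// !mulr_ge0.
have -> : 18 * (2 + beta) * B ^+ 2 =
    36 * MO%:R ^+ 2 * (2 + beta) * (2 * G * M%:R) ^+ (2 * n).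
  by rewrite /B exprMn sqr_sqrtr// exprMn -exprM [(n * 2)%N]mulnC; ring.
move: hm; rewrite -/G => hm.
have c2 : 0 < eps ^+ 2 by rewrite exprn_gt0.
(* After division by [eps ^+ 2] the required lower bound on [m] is exactly the left side of the
   hypothesis, so an equality remains. *)
rewrite -ltr_pdivrMr//; apply: le_lt_trans hm.
rewrite le_eqVlt; apply/orP; left; apply/eqP.
have -> : (2 * G * M%:R * N%:R * t) ^+ (2 * n) =
    (2 * G * M%:R) ^+ (2 * n) * (N%:R * t) ^+ (2 * n).
  by rewrite -exprMn; congr (_ ^+ _); ring.
have -> : eps ^+ 2 = delta ^+ 2 * n`!%:R ^+ 2 / (N%:R * t) ^+ (2 * n).
  by rewrite /eps expr_div_n exprMn -exprM [(n * 2)%N]mulnC.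
have : 0 < (N%:R * t) ^+ (2 * n) by rewrite exprn_gt0// mulr_gt0// ltr0n.
move: ((N%:R * t) ^+ (2 * n)) => b b_gt0; field.
by rewrite !gt_eqF.
Qed.
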